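(* Let $\Omega \subset \mathbb{R}$ be a union of $n$ intervals, $\Omega=\bigcup_{j=1}^n I_j$, such that $|\Omega|=1$, and let $\Lambda\subset\mathbb{R}$. If $(\Omega,\Lambda)$ is a spectral pair, then $\Lambda$ is a $d$-periodic set for some $d\in\mathbb{N}$ (positive integer). Thus $\Lambda$ has the form $\Lambda=\bigcup_{j=1}^d (\lambda_j + d\mathbb{Z})$ for some $\lambda_1,\dots,\lambda_d\in\mathbb{R}$.
   Context: $|\cdot|$ is Lebesgue measure. For a measurable set $\Omega\subset\mathbb{R}$ of finite positive measure and $\lambda\in\mathbb{R}$, put $e_\lambda(x)=|\Omega|^{-1/2}e^{2\pi i\lambda x}\chi_\Omega(x)$. The pair $(\Omega,\Lambda)$, with $\Lambda\subset\mathbb{R}$, is a spectral pair (and $\Lambda$ is a spectrum for $\Omega$) if $\{e_\lambda:\lambda\in\Lambda\}$ is an orthonormal basis of $L^2(\Omega)$. A set $\Lambda\subset\mathbb{R}$ is $d$-periodic ($d>0$) if $\Lambda$ is a finite union of cosets of $d\mathbb{Z}$. *)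

(* Defs.v *)
From HB Require Import structures.
From mathcomp Require Export all_boot all_order all_algebra.
From mathcomp.real_closed Require Export complex.
From mathcomp Require Export all_classical all_reals all_analysis.

Set Implicit Arguments.
Unset Strict Implicit.
Unset Printing Implicit Defensive.

Import Order.TTheory GRing.Theory Num.Theory.
Import numFieldNormedType.Exports.

Local Open Scope classical_set_scope.
Local Open Scope ring_scope.
Local Open Scope complex_scope.

Section L2.
Context {R : realType}.
Notation mu := (@lebesgue_measure R).

(* Elements of L^2(Omega) are represented by functions R -> C of which only
   the values on Omega matter.  Measurability is with respect to the Borel
   sigma-algebra carried by R in the library: every Lebesgue measurable
   function agrees almost everywhere with a Borel one, so the space is the
   usual one. *)
Definition L2normsq (Omega : set R) (f : R -> R[i]) : \bar R :=
  (\int[mu]_(x in Omega) (ComplexField.Normc.normc (f x) ^+ 2)%:E)%E.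

Definition inL2 (Omega : set R) (f : R -> R[i]) : Prop :=
  [/\ measurable_fun Omega (fun x => complex.Re (f x)),
      measurable_fun Omega (fun x => complex.Im (f x)) &
      (L2normsq Omega f < +oo)%E].

Definition Cintegral (Omega : set R) (f : R -> R[i]) : R[i] :=
  (\int[mu]_(x in Omega) complex.Re (f x))
    +i* (\int[mu]_(x in Omega) complex.Im (f x)).

Definition L2dot (Omega : set R) (f g : R -> R[i]) : R[i] :=
  Cintegral Omega (fun x => f x * (g x)^*).

(* An orthonormal family whose finite linear combinations are dense. *)
Definition orthonormal_basis_L2 (Omega : set R) (I : eqType) (J : set I)
    (e : I -> R -> R[i]) : Prop :=
  [/\ forall i, J i -> inL2 Omega (e i),
      forall i j, J i -> J j -> L2dot Omega (e i) (e j) = (i == j)%:R &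
      forall (f : R -> R[i]) (eps : R), inL2 Omega f -> 0 < eps ->
        exists (s : seq I) (c : I -> R[i]),
          (forall i, i \in s -> J i) /\
          (L2normsq Omega (fun x => f x - \sum_(i <- s) c i * e i x)%R
             < (eps ^+ 2)%:E)%E].

Definition expi (t : R) : R[i] := cos t +i* sin t.

Definition exp_fun (Omega : set R) (lambda x : R) : R[i] :=
  ((Num.sqrt (fine (mu Omega)))^-1)%:C
    * expi (2 * pi * lambda * x) * (\1_Omega x)%:C.

(* Meaningful for Omega measurable of finite positive measure. *)
Definition spectral_pair (Omega Lambda : set R) : Prop :=
  orthonormal_basis_L2 Omega Lambda (exp_fun Omega).

Definition coset (d a : R) : set R := [set x | exists k : int, x = a + d * k%:~R].

Definition periodic_set (d : R) (Lambda : set R) : Prop :=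
  exists2 F : set R, finite_set F & Lambda = \bigcup_(a in F) coset d a.

End L2.

(* Main.v *)
Require Import Defs.
From mathcomp Require Import ring lra measurable_realfun.

Import Order.TTheory GRing.Theory Num.Theory.
Import numFieldNormedType.Exports.

Local Open Scope classical_set_scope.
Local Open Scope ring_scope.
Local Open Scope complex_scope.

(* Write e_t(x) = exp(2 pi i t x).  For a finite union Omega of intervals with
   endpoints xi_j, fixed weights c_j give 2 pi i t <e_t, 1> = E(t) :=
   sum_j c_j exp(2 pi i xi_j t), so for y <> a orthogonality of e_y and e_a means
   E(y - a) = 0.  Three facts force periodicity of a spectrum.
   (1) The zeros of E are locally finite: at an accumulation point all derivatives
   of E vanish, which by interpolation forces sum_j c_j xi_j = |Omega| to vanish.
   (2) E(y - a) is linear in the vector of phases of a, so only the span of the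
   phase vectors of a window of the spectrum matters.
   (3) By Parseval, 1/t decay and separation, y belongs to the spectrum as soon as
   it is orthogonal to the elements within a fixed distance T of y.
   Let m be least such that arbitrarily large windows may span only dimension m, and
   let L1 be a radius from which every window spans at least that much.  Larger and
   larger windows spanning dimension m have the span of their central part of radius
   L1, and by (1) infinitely many of these parts have the same shape P; (2) and (3)
   show that the whole spectrum is a translate of the set orthogonal to P.  Two such
   windows at different places give a period.  If their place is always the same, all
   windows of radius L1 have full span, and any two of equal shape give a period.
   Finally replace the period by a multiple p such that Omega contains an interval
   J of length 1/p.  Parseval for a modulated indicator of J and the partial
   fraction expansion of 1/sin^2 show that each coset of pZ contributes p^-2 to a
   sum whose value is |J| = 1/p; hence p is the number of cosets. *)

Set Implicit Arguments.
Unset Strict Implicit.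

(** * Locally finite sets governed by a local rule are periodic *)

Section LocalRule.
(* [Z (y - a)] is to be read as: the exponentials of frequencies [y] and [a] are
   orthogonal or equal. *)
Variables (R : realType) (F : fieldType) (vT : vectType F) (phi : R -> vT).
Variables (Z : R -> Prop) (Lam : set R) (T : R).
Hypothesis T_ge0 : 0 <= T.
Hypothesis spanZ : forall y (s : seq R) a, phi a \in <<map phi s>>%VS ->
  (forall z, z \in s -> Z (y - z)) -> Z (y - a).
Hypothesis finZ : forall L : nat, exists s : seq R,
  forall t, Z t -> `|t| <= L%:R -> t \in s.
Hypothesis LamZ : forall a b, Lam a -> Lam b -> Z (a - b).
Hypothesis localZ : forall y,
  (forall a, Lam a -> `|a - y| <= T -> Z (y - a)) -> Lam y.

(** Otherwise each value has a bound beyond which it is never taken, and [f] at the maximum of these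
    bounds has no value left. *)
Lemma pigeonhole_nat (U : finType) (f : nat -> U) :
  exists u, forall n, exists2 m, (n <= m)%N & f m = u.
Proof.
apply: contrapT => h.
have h1 u : exists n, forall m, (n <= m)%N -> f m <> u.
  apply: contrapT => h2; apply: h; exists u => n; apply: contrapT => h3.
  by apply: h2; exists n => m nm fm; apply: h3; exists m.
have [N NP] := choice h1.
by apply: (NP (f (\max_u N u))) (erefl _); exact: leq_bigmax.
Qed.

Lemma local_rule_periodic :
  exists2 p : R, 0 < p & forall x, Lam x <-> Lam (x + p).
Proof.
suff [p p0 pP] : exists2 p : R, p != 0 & forall x, Lam x <-> Lam (x + p).
  have [pgt|ple] := ltP 0 p; first by exists p.
  exists (- p); first by rewrite oppr_gt0 lt_neqAle p0.
  by move=> x; split=> [|/pP]; [rewrite (pP (x - p)) subrK|rewrite subrK].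
have [s0 s0P] := choice finZ.
(* The window of radius [L] at [x]: differences in [Lam] satisfy [Z], so the finite list [s0 L]
   contains every candidate offset. *)
pose W L x := [seq x + z | z <- s0 L & (x + z \in Lam) && (`|z| <= L%:R)].
have WP L x a : Lam x -> reflect (Lam a /\ `|a - x| <= L%:R) (a \in W L x).
  move=> Lx; apply: (iffP mapP) => [[z]|[La ax]].
    rewrite mem_filter => /andP[/andP[+ zL] _ ->] => /set_mem ?.
    by rewrite (addrC x) addrK -(addrC x).
  exists (a - x); last by rewrite addrC subrK.
  by rewrite mem_filter addrC subrK ax s0P //= ?andbT ?mem_set//; exact: LamZ.
pose r L x := \dim <<map phi (W L x)>>%VS.
have WS L L' x : Lam x -> (L <= L')%N ->
    (<<map phi (W L x)>> <= <<map phi (W L' x)>>)%VS.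
  move=> Lx LL; apply: sub_span => _ /mapP[a aW ->]; apply: map_f.
  apply/WP => //; have [La aL] := WP L x a Lx aW; split => //.
  by rewrite (le_trans aL)// ler_nat.
have exm : exists m, `[< forall L, exists2 x, Lam x & (r L x <= m)%N >].
  exists (dim vT); apply/asboolP => L.
  (* If [Lam] were empty, the premise of [localZ] would hold vacuously and put 0 in [Lam]. *)
  have [a La] : exists a, Lam a.
    apply: contrapT => h; apply: (h); exists 0; apply: localZ => a La.
    by case: h; exists a.
  by exists a => //; rewrite -dimvf dimvS // subvf.
case: (ex_minnP exm) => m /asboolP mP mmin.
have [L1 L1P] : exists L1, forall x, Lam x -> (m <= r L1 x)%N.
  case: m mP mmin => [|m] mP mmin; first by exists 0%N.
  apply: contrapT => h; suff : (m < m)%N by rewrite ltnn.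
  apply: mmin; apply/asboolP => L; apply: contrapT => h2; apply: h; exists L.
  by move=> x Lx; rewrite ltnNge; apply/negP => h3; apply: h2; exists x.
have spanE x L : Lam x -> (L1 <= L)%N -> (r L x <= m)%N ->
    <<map phi (W L1 x)>>%VS = <<map phi (W L x)>>%VS.
  move=> Lx LL rL; apply/eqP; rewrite eqEdim WS//=.
  by rewrite (leq_trans rL)// L1P.
(* The shape of the window of radius [L1], recorded in a finite type for the pigeonhole
   principle. *)
pose pat x := [tuple x + nth 0 (s0 L1) i \in Lam | i < size (s0 L1)].
have patP x x' z : pat x = pat x' -> Lam x -> Lam x' ->
    x + z \in W L1 x -> x' + z \in W L1 x'.
  move=> pxx' Lx Lx' /(WP _ _ _ Lx)[Lz]; rewrite addrC addKr => zL.
  apply/WP => //; rewrite (addrC x') addrK -(addrC x'); split=> //.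
  have zs : z \in s0 L1.
    by apply: s0P => //; rewrite -(addKr x z) addrC; exact: LamZ.
  have zi : (index z (s0 L1) < size (s0 L1))%N by rewrite index_mem.
  have := congr1 (fun t : _.-tuple bool => tnth t (Ordinal zi)) pxx'.
  by rewrite !tnth_mktuple /= nth_index// (mem_set Lz) => /esym /set_mem.
(* By [spanE], the central part of radius [L1] of such a window already spans all of it. *)
have xsex L : exists x, Lam x /\ (r (L1 + L)%N x <= m)%N.
  by have [x ? ?] := mP (L1 + L)%N; exists x.
have [xs xsP] := choice xsex.
have xsL L : Lam (xs L) by have [] := xsP L.
have [u uP] := pigeonhole_nat (pat \o xs).
have [k0 _ /= k0u] := uP 0%N.
have xsI k z : pat (xs k) = u -> (xs k0 + z \in W L1 (xs k0)) = (xs k + z \in W L1 (xs k)).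
  by move=> ku; apply/idP/idP; apply: patP => //; rewrite ku k0u.
(* [Q] is the set orthogonal to the common shape, in coordinates centred at [xs k0]; by [xsI] any
   [xs k] of shape [u] gives the same set. *)
pose Q y := forall z, xs k0 + z \in W L1 (xs k0) -> Z (y - z).
have LQ k a : pat (xs k) = u -> Lam a -> Q (a - xs k).
  move=> ku La z; rewrite (xsI k)// => /(WP _ _ _ (xsL k))[Lz _].
  by rewrite -addrA -opprD; exact: LamZ.
have phiW k a : pat (xs k) = u -> Lam a -> `|a - xs k| <= (L1 + k)%:R ->
    phi a \in <<map phi (W L1 (xs k))>>%VS.
  move=> ku La ak; rewrite (spanE _ (L1 + k)%N) ?leq_addr//; last by have [] := xsP k.
  by apply/memv_span/map_f/WP.
have QZ k y z : pat (xs k) = u -> Q y -> z \in W L1 (xs k) -> Z (y + xs k - z).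
  move=> ku Qy zW; rewrite -addrA -opprB; apply: Qy.
  by rewrite (xsI k)// addrC subrK.
(* The points of [Lam] within [T] of [y + xs k] still lie in the window of radius [L1 + k], so their
   phases are in the span of its central part. *)
have QL1 k y : pat (xs k) = u -> Q y -> `|y| + T <= (L1 + k)%:R -> Lam (y + xs k).
  move=> ku Qy yk; apply: localZ => a La aT; apply: (spanZ (s := W L1 (xs k))).
    apply: phiW => //; apply: le_trans yk.
    have -> : a - xs k = y + (a - (y + xs k)) by ring.
    by rewrite (le_trans (ler_normD _ _))// lerD2l.
  by move=> z; exact: QZ.
have far (b : R) : exists2 k, pat (xs k) = u & b <= (L1 + k)%:R.
  have [k bk /= ku] := uP (Num.truncn b).+1.
  exists k => //; rewrite (le_trans (ltW (truncnS_gt b)))// ler_nat.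
  by rewrite (leq_trans bk)// leq_addl.
have QQ y y' : Q y -> Q y' -> Z (y - y').
  move=> Qy Qy'; have [k ku] := far (`|y| + `|y'| + T) => kb.
  have -> : y - y' = (y + xs k) - (y' + xs k) by ring.
  by apply: LamZ; apply: QL1 => //; apply: le_trans kb; rewrite lerD2r ?lerDl ?lerDr.
(* The size restriction of [QL1] disappears: points of [Lam] seen from [xs k] satisfy [Q], and [QQ]
   relates any two points of [Q]. *)
have QL k y : pat (xs k) = u -> Q y <-> Lam (y + xs k).
  move=> ku; split => [Qy|/(LQ k _ ku)]; last by rewrite addrK.
  apply: localZ => a La _; have -> : y + xs k - a = y - (a - xs k) by ring.
  by apply: QQ => //; exact: LQ.
(* [Lam] is the translate of [Q] by every centre of shape [u], so two distinct centres differ by a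
   period. *)
have [[k ku kx]|xsE] := pselect (exists2 k, pat (xs k) = u & xs k <> xs k0).
  exists (xs k - xs k0); first by rewrite subr_eq0; apply/eqP.
  move=> x; rewrite -[in X in X <-> _](subrK (xs k0) x) -QL// (QL k)//.
  by rewrite addrA addrAC.
have {}xsE k : pat (xs k) = u -> xs k = xs k0.
  by move=> ku; apply: contrapT => kx; apply: xsE; exists k.
(* The windows of radius [L1] now all span the same space. *)
have full z a : Lam z -> Lam a -> phi a \in <<map phi (W L1 z)>>%VS.
  have span0 b : Lam b -> phi b \in <<map phi (W L1 (xs k0))>>%VS.
    move=> Lb; have [k ku bk] := far `|b - xs k0|.
    by rewrite -(xsE k)// phiW// (xsE k).
  move=> Lz La; suff -> : <<map phi (W L1 z)>>%VS = <<map phi (W L1 (xs k0))>>%VS by exact: span0.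
  apply/eqP; rewrite eqEdim; apply/andP; split.
    by apply/span_subvP => _ /mapP[b /(WP _ _ _ Lz)[Lb _] ->]; exact: span0.
  apply: leq_trans (L1P z Lz); have [_] := xsP k0; apply: leq_trans.
  by apply: dimvS; rewrite WS// leq_addr.
have LW z y : Lam z -> (forall b, b \in W L1 z -> Z (y - b)) -> Lam y.
  by move=> Lz yW; apply: localZ => a La _; apply: (spanZ (s := W L1 z)) => //; exact: full.
(* A gap of radius [T] around [y] would make the premise of [localZ] vacuous, and [y] itself would
   fill it. *)
have dense y : exists2 a, Lam a & `|a - y| <= T.
  apply: contrapT => h; have Ly : Lam y.
    by apply: localZ => a La ay; case: h; exists a.
  by apply: h; exists y; rewrite // subrr normr0.
(* The spacing [3 * (T + 1)] exceeds twice the error [T], so the chosen points are distinct. *)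
have zsex (k : nat) : exists a, Lam a /\ `|a - 3 * (T + 1) * k%:R| <= T.
  by have [a ? ?] := dense (3 * (T + 1) * k%:R); exists a.
have [zs zsP] := choice zsex.
have zsL k : Lam (zs k) by have [] := zsP k.
have [v vP] := pigeonhole_nat (pat \o zs).
have [k1 _ /= k1v] := vP 0%N.
have [k2 k12 /= k2v] := vP k1.+1.
(* It suffices to test the translate against the window at [zs k']; moved back to [zs k], that
   window consists of points of [Lam]. *)
have trans k k' x : pat (zs k) = pat (zs k') -> Lam x -> Lam (x + (zs k' - zs k)).
  move=> kk' Lx; apply: (LW (zs k')) => // b bW.
  have -> : x + (zs k' - zs k) - b = x - (zs k + (b - zs k')) by ring.
  apply: LamZ => //; suff /WP : zs k + (b - zs k') \in W L1 (zs k) by case.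
  by apply: (patP (zs k')); rewrite ?kk'// addrC subrK.
exists (zs k2 - zs k1).
  rewrite subr_eq0; apply/eqP => z12.
  have [_ +] := zsP k1; have [_] := zsP k2; rewrite z12 !ler_distl.
  have : (k1%:R + 1 <= k2%:R :> R) by rewrite natr1 ler_nat.
  move=> kk; have T1 : 0 <= T + 1 by rewrite addr_ge0.
  have : 3 * (T + 1) * k1%:R + 3 * (T + 1) <= 3 * (T + 1) * k2%:R.
    rewrite -[X in _ + X]mulr1 -mulrDr ler_wpM2l ?mulr_ge0//.
  have T0 := T_ge0; clear k0u k1v k2v; by move=> ? /andP[? ?] /andP[? ?]; lra.
move=> x; split; first by apply: trans; rewrite k1v k2v.
move=> Lx; have -> : x = x + (zs k2 - zs k1) + (zs k1 - zs k2) by ring.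
by apply: trans => //; rewrite k1v k2v.
Qed.
End LocalRule.

(** * Partial fractions of 1/sin^2 with an explicit error *)

Section CosecantSeries.
Context {R : realType}.
Implicit Types x u : R.

Lemma sin_le_id u : 0 <= u -> sin u <= u.
Proof.
move=> u0; rewrite -subr_ge0.
have D x : is_derive x 1 (fun x : R => x - sin x) (1 - cos x).
  by apply: is_deriveB.
have := @ger0_derive1_ndecry R (fun x => x - sin x) 0 _ _ _ 0 u (lexx _) u0.
rewrite sin0 subr0; apply.
- by move=> x _; exact: (@ex_derive _ _ _ _ _ _ _ (D x)).
- by move=> x _; rewrite derive1E (@derive_val _ _ _ _ _ _ _ (D x)) subr_ge0 cos_le1.
- apply: derivable_within_continuous => x _.
  exact: (@ex_derive _ _ _ _ _ _ _ (D x)).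
Qed.

Lemma mul_cos_le_sin u : 0 <= u <= pi / 2 -> u * cos u <= sin u.
Proof.
move=> /andP[u0 upi]; rewrite -subr_ge0.
have D x : is_derive x 1 (fun x : R => sin x - x * cos x) (x * sin x).
  apply: is_derive_eq; rewrite /GRing.scale /= mulr1.
  by ring.
have := @ger0_derive1_ndecr R (fun x => sin x - x * cos x) 0 (pi / 2) _ _ _ 0 u (lexx _) u0 upi.
rewrite sin0 mul0r subr0; apply.
- by move=> x _; exact: (@ex_derive _ _ _ _ _ _ _ (D x)).
- move=> x /[!in_itv]/= /andP[x0 xpi]; rewrite derive1E (@derive_val _ _ _ _ _ _ _ (D x)).
  rewrite mulr_ge0 ?(ltW x0)// sin_ge0_pi// (ltW x0)/= (le_trans (ltW xpi))//.
  by have := pi_gt0 R; lra.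
- apply: derivable_within_continuous => x _.
  exact: (@ex_derive _ _ _ _ _ _ _ (D x)).
Qed.

Lemma sin_gt0_le_pihalf u : 0 < u <= pi / 2 -> 0 < sin u.
Proof.
move=> /andP[u0 upi]; apply: sin_gt0_pi; rewrite u0 (le_lt_trans upi)//.
by have := pi_gt0 R; lra.
Qed.

(** For the upper bound, square [u * cos u <= sin u] and replace cos^2 by 1 - sin^2: this gives u^2
    <= (1 + u^2) sin^2 u. *)
Lemma cosecant_sqr_bounds u : 0 < `|u| <= pi / 2 ->
  u ^- 2 <= (sin u) ^- 2 <= u ^- 2 + 1.
Proof.
suff H (v : R) : 0 < v <= pi / 2 -> v ^- 2 <= (sin v) ^- 2 <= v ^- 2 + 1.
  have [ug|ul] := leP 0 u; first by rewrite ger0_norm//; exact: H.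
  by rewrite ltr0_norm// => /H; rewrite sinN !sqrrN.
move=> vP; have s0 := sin_gt0_le_pihalf vP; have /andP[v0 vpi] := vP.
have sv := sin_le_id (ltW v0).
have vc : v * cos v <= sin v by apply: mul_cos_le_sin; rewrite (ltW v0).
have c0 : 0 <= cos v.
  by apply: cos_ge0_pihalf; rewrite vpi andbT (le_trans _ (ltW v0))// oppr_le0 divr_ge0 ?pi_ge0.
have s2 := sin2cos2 v.
apply/andP; split; first by rewrite lef_pV2 ?posrE ?exprn_gt0// lerXn2r ?nnegrE// ltW.
have -> : v ^- 2 + 1 = (v ^+ 2) ^-1 * (1 + v ^+ 2) by rewrite mulrDr mulVf ?mulr1// gt_eqF ?exprn_gt0.
rewrite -[X in X <= _]mul1r ler_pdivrMr ?exprn_gt0// mulrAC -mulrA mulrC ler_pdivlMr ?exprn_gt0//.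
have : (v * cos v) ^+ 2 <= sin v ^+ 2 by rewrite lerXn2r ?nnegrE ?mulr_ge0// ltW.
rewrite exprMn s2; nra.
Qed.

(** Divide cos^2 + sin^2 = 1 at x/2 by the square of sin x = 2 sin(x/2) cos(x/2); the shift by pi
    turns the cosine into a sine. *)
Lemma cosecant_sqr_dup x : sin x != 0 ->
  (sin x) ^- 2 = 4^-1 * ((sin (x / 2)) ^- 2 + (sin ((x + pi) / 2)) ^- 2).
Proof.
rewrite mulrDl sinDpihalf {1 2}[x]splitr -mulr2n sin_mulr2n -mulr_natl !mulf_eq0.
rewrite !negb_or => /and3P[_ c0 s0].
have := cos2Dsin2 (x / 2); set c := cos _ in c0 *; set s := sin _ in s0 * => cs.
rewrite -(mul1r ((_ * _) ^- 2)) -{1}cs; field.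
by rewrite c0 s0.
Qed.

Lemma sin_mulX2 n x : sin x = 0 -> sin (x * 2 ^+ n) = 0.
Proof.
move=> x0; elim: n => [|n IH]; first by rewrite expr0 mulr1.
by rewrite exprSr mulrA mulr_natr sin_mulr2n IH mulr0 mul0rn.
Qed.

Lemma sqr_sinDpin x k : sin (x + pi * k%:R) ^+ 2 = sin x ^+ 2.
Proof.
elim: k => [|k IH]; first by rewrite mulr0 addr0.
by rewrite -natr1 mulrDr mulr1 addrA sinDpi sqrrN.
Qed.

Lemma cosecant_sqr_sum (n : nat) x : sin x != 0 ->
  (sin x) ^- 2 = 4 ^- n * \sum_(k < 2 ^ n) (sin ((x + pi * k%:R) / 2 ^+ n)) ^- 2.
Proof.
move=> x0; elim: n => [|n IH].
  by rewrite big_ord1 mulr0 addr0 !expr0 !divr1 invr1 mul1r.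
rewrite IH exprSr invfM -mulrA; congr (_ * _); rewrite mulr_sumr.
(* Duplication splits the term of index [k] into those of indices [k] and [2 ^ n + k]. *)
rewrite expnS mul2n -addnn big_split_ord /=.
rewrite -big_split /=.
apply: eq_bigr => k _; rewrite -mulrDr cosecant_sqr_dup; last first.
  apply/eqP => /(sin_mulX2 n); rewrite divfK ?expf_neq0// => /eqP.
  by rewrite -sqrf_eq0 sqr_sinDpin sqrf_eq0 (negPf x0).
congr (_ * ((sin _) ^- 2 + (sin _) ^- 2)).
  by rewrite (exprSr 2 n) invfM mulrA.
rewrite natrD natrX (exprSr 2 n); field.
by rewrite expf_neq0.
Qed.

(** Each of the [2 ^ n] terms of [cosecant_sqr_sum] exceeds its counterpart by at most [4 ^- n],
    whence the total error [2 ^- n]. The bound on [x + pi * k%:R] keeps the rescaled arguments in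
    the range of [cosecant_sqr_bounds]. *)
Lemma cosecant_sqr_partial_sum (n : nat) x : sin x != 0 ->
    (forall k, (k < 2 ^ n)%N -> `|x + pi * k%:R| <= 2 ^+ n * (pi / 2)) ->
  (sin x) ^- 2 - 2 ^- n <= \sum_(k < 2 ^ n) (x + pi * k%:R) ^- 2 <= (sin x) ^- 2.
Proof.
move=> x0 xk; have p2 : 0 < 2 ^+ n :> R by rewrite exprn_gt0.
have b (k : 'I_(2 ^ n)) : (x + pi * k%:R) ^- 2 <=
    4 ^- n * sin ((x + pi * k%:R) / 2 ^+ n) ^- 2 <= (x + pi * k%:R) ^- 2 + 4 ^- n.
  have e : 4 ^- n = (2 ^+ n) ^- 2 :> R by rewrite -exprM mulnC exprM expr2 -natrM.
  have xkn0 : x + pi * k%:R != 0.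
    apply: contra x0 => /eqP e0; rewrite -sqrf_eq0 -(sqr_sinDpin x k) e0.
    by rewrite sin0 sqrf_eq0.
  move: xkn0 (xk k (ltn_ord k)); move: (x + pi * k%:R) => v v0 vk.
  have B : 0 < `|v / 2 ^+ n| <= pi / 2.
    rewrite normr_gt0 mulf_neq0 ?invr_eq0 ?(gt_eqF p2)//=.
    by rewrite normrM normfV (gtr0_norm p2) ler_pdivrMr// (mulrC (pi / 2)).
  move: (cosecant_sqr_bounds B).
  have -> : v ^- 2 = 4 ^- n * (v / 2 ^+ n) ^- 2.
    by rewrite e; field; rewrite v0 gt_eqF.
  have -> : forall t : R, 4 ^- n * t + 4 ^- n = 4 ^- n * (t + 1) by move=> t; ring.
  by rewrite !ler_pM2l// ?invr_gt0 ?exprn_gt0.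
rewrite (cosecant_sqr_sum n x0) lerBlDr mulr_sumr; apply/andP; split; last first.
  by apply: ler_sum => k _; case/andP: (b k).
apply: (le_trans (ler_sum _ (fun k _ => proj2 (andP (b k))))).
rewrite big_split /= lerD2l sumr_const card_ord -(mulr_natl (4 ^- n)) natrX.
have -> : 4 ^+ n = 2 ^+ n * 2 ^+ n :> R by rewrite -exprMn -natrM.
by rewrite invfM mulrA divff ?mul1r// gt_eqF.
Qed.

End CosecantSeries.

(** * Local finiteness of the common zeros of cosine and sine sums *)

Section TrigonometricZeros.
Context {R : realType}.

Lemma interpolation (g : R -> R) (s : seq R) :
  exists p : {poly R}, forall x, x \in s -> p.[x] = g x.
Proof.
elim: s => [|x s [p ps]]; first by exists 0.
have [xs|xs] := boolP (x \in s).
  by exists p => y; rewrite inE => /predU1P[->|]; exact: ps.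
pose q := \prod_(y <- s) ('X - y%:P).
have qx : q.[x] != 0 by rewrite -/(root q x) root_prod_XsubC.
exists (p + ((g x - p.[x]) / q.[x]) *: q) => y.
rewrite inE hornerD hornerZ => /predU1P[->|ys]; first by rewrite divfK// addrC subrK.
suff /eqP -> : root q y by rewrite mulr0 addr0 ps.
by rewrite root_prod_XsubC.
Qed.

Definition zeros_cluster (f : R -> R) (a : R) :=
  forall e, 0 < e -> exists2 t, f t = 0 & 0 < `|t - a| < e.

Lemma zeros_cluster_eq0 (f : R -> R) (a : R) :
  {for a, continuous f} -> zeros_cluster f a -> f a = 0.
Proof.
move=> fc facc; apply: contrapT => /eqP fa.
have : \forall t \near a, f t != 0 by exact: (cvgr_neq0 (f a) fc fa).
move=> /nbhs_ballP[e /= e0 eb]; have [t ft /andP[_ te]] := facc e e0.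
by have := eb t; rewrite /ball /= distrC te ft eqxx => /(_ isT).
Qed.

(** By continuity [f a = 0]; Rolle's theorem between [a] and a nearby zero of [f] gives a zero of
    [g] still closer to [a] and different from it. *)
Lemma zeros_cluster_derive (f g : R -> R) (a : R) :
  (forall x : R, is_derive x 1 f (g x)) -> zeros_cluster f a -> zeros_cluster g a.
Proof.
move=> fg facc e e0; have [t ft /andP[t0 te]] := facc e e0.
have fc x : {for x, continuous f}.
  apply: differentiable_continuous; apply/derivable1_diffP.
  exact: (@ex_derive _ _ _ _ _ _ _ (fg x)).
have fa := zeros_cluster_eq0 (fc a) facc.
have rol b c : b < c -> f b = f c -> exists2 x, g x = 0 & b < x < c.
  move=> bc fbc; have [||x xbc xd] := @Rolle R f b c bc _ _ fbc.
  - by move=> x _; exact: (@ex_derive _ _ _ _ _ _ _ (fg x)).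
  - by apply: continuous_subspaceT => x; exact: fc.
  exists x; last by rewrite in_itv in xbc.
  by rewrite -(@derive_val _ _ _ _ _ _ _ (fg x)) (@derive_val _ _ _ _ _ _ _ xd).
have [ta|at_|tE] := ltgtP t a.
- have [|x gx /andP[tx xa]] := rol t a ta; first by rewrite ft fa.
  exists x => //; rewrite ltr0_norm ?subr_lt0//; rewrite ltr0_norm ?subr_lt0// in te; apply/andP; split; lra.
- have [|x gx /andP[tx xa]] := rol a t at_; first by rewrite ft fa.
  exists x => //; rewrite gtr0_norm ?subr_gt0//; rewrite gtr0_norm ?subr_gt0// in te; apply/andP; split; lra.
- by rewrite tE subrr normr0 ltxx in t0.
Qed.

Section Sums.
Variables (N : nat) (c w : 'I_N -> R).
(** Up to sign, [C k] and [S k] are the k-th derivatives of [C 0] and [S 0], exchanged when k is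
    odd. *)
Let C k t := \sum_j c j * w j ^+ k * cos (w j * t).
Let S k t := \sum_j c j * w j ^+ k * sin (w j * t).

Lemma is_derive_cos_sum k (t : R) : is_derive t 1 (C k) (- S k.+1 t).
Proof.
have D j : is_derive t 1 (fun t => c j * w j ^+ k * cos (w j * t)) 
   (- (c j * w j ^+ k.+1 * sin (w j * t))).
  apply: is_derive_eq; rewrite /GRing.scale /= exprSr; ring.
rewrite (_ : C k = \sum_j (fun t => c j * w j ^+ k * cos (w j * t))).
  rewrite /S -sumrN; exact: is_derive_sum D.
by apply/funext => x; rewrite fct_sumE.
Qed.

Lemma is_derive_sin_sum k (t : R) : is_derive t 1 (S k) (C k.+1 t).
Proof.
have D j : is_derive t 1 (fun t => c j * w j ^+ k * sin (w j * t)) 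
   (c j * w j ^+ k.+1 * cos (w j * t)).
  apply: is_derive_eq; rewrite /GRing.scale /= exprSr; ring.
rewrite (_ : S k = \sum_j (fun t => c j * w j ^+ k * sin (w j * t))).
  exact: is_derive_sum D.
by apply/funext => x; rewrite fct_sumE.
Qed.

(** At an accumulation point [a] of zeros all [C k] and [S k] vanish, so the powers of [w j] may be
    replaced by any polynomial in [w j]. Interpolating [x * cos (x * a)] and [x * sin (x * a)] at
    the frequencies and adding gives the sum of the [c j * w j], by cos^2 + sin^2 = 1. *)
Lemma trig_zeros_finite (L : R) : \sum_j c j * w j != 0 ->
  finite_set [set t | [/\ `|t| <= L, \sum_j c j * cos (w j * t) = 0 &
                          \sum_j c j * sin (w j * t) = 0]].
Proof.
move=> cw0; apply: contrapT => /infinite_bounded_limit_point_nonempty[].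
  exists L; split; first exact: num_real.
  by move=> M LM t /= [tL _ _]; rewrite (le_trans tL)// ltW.
move=> a alim.
have acc k : zeros_cluster (C k) a /\ zeros_cluster (S k) a.
  elim: k => [|k [Ck Sk]]; last first.
    split; first exact: (zeros_cluster_derive (is_derive_sin_sum k) Sk).
    have := zeros_cluster_derive (is_derive_cos_sum k) Ck.
    by move=> h e /h[t /eqP]; rewrite oppr_eq0 => /eqP tS te; exists t.
  split=> e e0; have [t [ta [_ t1 t2] te]] := alim _ (nbhsx_ballx a e e0).
    exists t; last by rewrite normr_gt0 subr_eq0 ta distrC.
    by rewrite -t1; apply: eq_bigr => j _; rewrite expr0 mulr1.
  exists t; last by rewrite normr_gt0 subr_eq0 ta distrC.
  by rewrite -t2; apply: eq_bigr => j _; rewrite expr0 mulr1.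
have cnt (f g : R -> R) : (forall x : R, is_derive x 1 f (g x)) -> {for a, continuous f}.
  move=> fg; apply: differentiable_continuous; apply/derivable1_diffP.
  exact: (@ex_derive _ _ _ _ _ _ _ (fg a)).
have C0 k : C k a = 0.
  by apply: zeros_cluster_eq0; [exact: (cnt _ _ (is_derive_cos_sum k))|exact: (acc k).1].
have S0 k : S k a = 0.
  by apply: zeros_cluster_eq0; [exact: (cnt _ _ (is_derive_sin_sum k))|exact: (acc k).2].
have poly0 (h : R -> R) : (forall k, \sum_j c j * w j ^+ k * h (w j) = 0) ->
    forall p : {poly R}, \sum_j c j * p.[w j] * h (w j) = 0.
  move=> h0 p; under eq_bigr => j _ do rewrite horner_coef mulr_sumr mulr_suml.
  rewrite exchange_big /= big1// => k _.
  transitivity (p`_k * \sum_j c j * w j ^+ k * h (w j)); last by rewrite h0 mulr0.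
  by rewrite mulr_sumr; apply: eq_bigr => j _; ring.
have wI j : w j \in [seq w j | j : 'I_N] by apply: map_f; rewrite mem_enum.
have [p pE] := interpolation (fun x => x * cos (x * a)) [seq w j | j : 'I_N].
have [q qE] := interpolation (fun x => x * sin (x * a)) [seq w j | j : 'I_N].
move/eqP: cw0; apply.
have := congr2 +%R (poly0 (fun x => cos (x * a)) C0 p) (poly0 (fun x => sin (x * a)) S0 q).
rewrite addr0 -big_split /= => e0; rewrite -[RHS]e0; apply: eq_bigr => j _; rewrite pE// qE//.
by rewrite -[LHS]mulr1 -(cos2Dsin2 (w j * a)); ring.
Qed.

End Sums.
End TrigonometricZeros.

(** * Integrals over finite unions of intervals through primitives *)

Lemma Rintegral_lincomb d (T : measurableType d) (R : realType)
    (mu : {measure set T -> \bar R}) (D : set T) (U : Type) (s : seq U) (c : U -> R)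
    (f : U -> T -> R) :
  measurable D -> (forall u, mu.-integrable D (EFin \o f u)) ->
  \int[mu]_(x in D) (\sum_(u <- s) c u * f u x) = \sum_(u <- s) c u * \int[mu]_(x in D) f u x.
Proof.
move=> mD fi; elim: s => [|u s IH].
  by under eq_Rintegral do rewrite big_nil; rewrite Rintegral_cst// mul0r big_nil.
under eq_Rintegral do rewrite big_cons.
have cfi v : mu.-integrable D (EFin \o (fun x => c v * f v x)).
  exact: (integrableZl mD (c v) (fi v)).
rewrite RintegralD//.
  by rewrite RintegralZl// IH big_cons.
rewrite (_ : EFin \o _ = (fun x => \sum_(u <- s) (c u * f u x)%R%:E)%E).
  by apply: integrable_sum => // v _; exact: cfi.
by apply/funext => x /=; rewrite sumEFin.
Qed.

Section IntervalUnions.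
Context {R : realType}.
Notation mu := (@lebesgue_measure R).

(* Inclusion-exclusion; intersections of intervals are intervals. *)
Lemma has_itv_decomposition (l : seq (interval R)) :
  exists s : seq (R * interval R),
    (forall u x, u \in s -> x \in u.2 -> has (fun i => x \in i) l) /\
    forall x : R, (has (fun i => x \in i) l)%:R = \sum_(u <- s) u.1 * (x \in u.2)%:R :> R.
Proof.
elim: l => [|i l [s [sl sE]]]; first by exists [::]; split => // x; rewrite big_nil.
exists ((1, i) :: s ++ [seq (- u.1, (i `&` u.2)%O) | u <- s]); split.
  move=> u x; rewrite inE mem_cat => /predU1P[-> /= ->//|/orP[us xu|/mapP[v vs ->]]] /=.
    by rewrite (sl _ _ us xu) orbT.
  by rewrite in_itvI => /andP[-> _].
move=> x /=; rewrite big_cons big_cat big_map /= -sE mul1r.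
case: (boolP (x \in i)) => xi /=.
  rewrite (eq_bigr (fun u => - (u.1 * (x \in u.2)%:R))); last first.
    by move=> u _; rewrite in_itvI xi mulNr.
  by rewrite sumrN -sE subrr addr0.
rewrite add0r big1 ?addr0// => u _.
by rewrite in_itvI (negPf xi) mulr0.
Qed.

Lemma finite_itv_bounded (J : interval R) :
  (mu [set` J] < +oo)%E -> exists M : R, forall x, x \in J -> `|x| <= M.
Proof.
rewrite lebesgue_measure_itv; case: J => [[b1 a|[]] [b2 b|[]]] /= muJ.
- exists (`|a| + `|b|) => x; rewrite itv_boundlr => /andP[ax xb].
  have {}ax : a <= x by case: b1 ax muJ => // /ltW.
  have {}xb : x <= b by case: b2 xb muJ => // /ltW.
  have := ler_norm (- a); have := ler_norm b; rewrite normrN => ? ?.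
  have := normr_ge0 a; have := normr_ge0 b => ? ?.
  by rewrite ler_norml; apply/andP; split; lra.
- by exists 0 => x; rewrite in_itv /= andbF.
- by move: muJ; rewrite ltry.
- by move: muJ; rewrite ltNyr.
- by exists 0 => x; rewrite in_itv.
- by move: muJ; rewrite ltxx.
- by exists 0 => x; rewrite in_itv.
- by exists 0 => x; rewrite in_itv.
- by exists 0 => x; rewrite in_itv.
Qed.

Lemma continuous_integrable (f : R -> R) (M : R) (D : set R) :
  measurable D -> (forall x, D x -> `|x| <= M) -> continuous f ->
  mu.-integrable D (EFin \o f).
Proof.
move=> mD DM fc; apply: (@integrableS _ _ _ mu `[- M, M]) => //.
  by move=> x /DM; rewrite /= in_itv /= ler_norml.
apply: continuous_compact_integrable; first exact: segment_compact.
exact: continuous_subspaceT.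
Qed.

Lemma Rintegral_segment_primitive (a b : R) (F f : R -> R) : a < b ->
  (forall x : R, is_derive x 1 F (f x)) -> continuous f ->
  \int[mu]_(x in `[a, b]) f x = F b - F a.
Proof.
move=> ab Ff fc.
have Fd x : derivable F x 1 by exact: (@ex_derive _ _ _ _ _ _ _ (Ff x)).
have Fc x : {for x, continuous F}.
  by apply: differentiable_continuous; apply/derivable1_diffP.
rewrite /Rintegral (@continuous_FTC2 _ f F)//.
- exact: continuous_subspaceT.
- split => //; [exact: cvg_at_right_filter (Fc a)|exact: cvg_at_left_filter (Fc b)].
- by move=> x _; rewrite derive1E; exact: (@derive_val _ _ _ _ _ _ _ (Ff x)).
Qed.

Lemma Rintegral_itv_primitive (J : interval R) : (mu [set` J] < +oo)%E ->
  exists a b : R, forall F f : R -> R,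
    (forall x : R, is_derive x 1 F (f x)) -> continuous f ->
    \int[mu]_(x in [set` J]) f x = F b - F a.
Proof.
move=> Joo; have [M JM] := finite_itv_bounded Joo.
move: Joo; rewrite lebesgue_measure_itv.
case: ifPn => J12 Joo; last first.
  have J0 : mu [set` J] = 0%E by rewrite lebesgue_measure_itv (negPf J12).
  (* A null interval may have no finite endpoints; any equal pair gives the integral 0. *)
  exists 0, 0 => F f _ fc; rewrite subrr /Rintegral null_set_integral//.
    by have /integrableP[] := continuous_integrable (measurable_itv J) JM fc.
case: J J12 Joo JM => [[b1 a|[]] [b2 b|[]]] //=.
rewrite lte_fin => ab _ JM.
exists a, b => F f Ff fc.
have fi (c d : bool) : mu.-integrable [set` Interval (BSide c a) (BSide d b)] (EFin \o f).
  have [|M' M'P] := @finite_itv_bounded (Interval (BSide c a) (BSide d b)).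
    by rewrite lebesgue_measure_itv /=; case: ifP => _; rewrite -?EFinD ltry.
  exact: (@continuous_integrable _ M').
have -> : \int[mu]_(x in [set` Interval (BSide b1 a) (BSide b2 b)]) f x =
    \int[mu]_(x in `[a, b]) f x.
  transitivity (\int[mu]_(x in [set` Interval (BLeft a) (BSide b2 b)]) f x).
    by case: b1 JM => // _; rewrite Rintegral_itv_obnd_cbnd.
  by case: b2 JM => // _; rewrite Rintegral_itv_bndo_bndc.
exact: Rintegral_segment_primitive.
Qed.


(** Each interval of the inclusion-exclusion formula contributes its coefficient at the right
    endpoint and the opposite one at the left. These intervals lie in [Om], so they have finite
    measure. One list serves all integrands. *)
Lemma itv_union_Rintegral (n : nat) (I : 'I_n -> interval R) (Om : set R) :
  Om = \bigcup_(j in [set: 'I_n]) [set` I j] -> (mu Om < +oo)%E ->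
  exists s : seq (R * R), forall F f : R -> R,
    (forall x : R, is_derive x 1 F (f x)) -> continuous f ->
    \int[mu]_(x in Om) f x = \sum_(u <- s) u.1 * F u.2.
Proof.
move=> OmE Omoo.
have mOm : measurable Om by rewrite OmE; apply: fin_bigcup_measurable.
have Omhas x : Om x <-> has (fun i => x \in i) [seq I j | j : 'I_n].
  rewrite OmE; split => [[j _ xj]|/hasP[i /mapP[j _ ->] xj]]; last by exists j.
  by apply/hasP; exists (I j) => //; apply: map_f; rewrite mem_enum.
have sub_oo (J : interval R) : [set` J] `<=` Om -> (mu [set` J] < +oo)%E.
  by move=> JOm; apply: le_lt_trans Omoo; apply: le_measure => //; rewrite inE.
have [s [sl sE]] := has_itv_decomposition [seq I j | j : 'I_n].
have [M OmM] : exists M : R, forall x, Om x -> `|x| <= M.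
  have /(_ _)/cid-/all_sig[m mP] j : exists M : R, forall x, x \in I j -> `|x| <= M.
    by apply: finite_itv_bounded; apply: sub_oo; rewrite OmE => x xj; exists j.
  exists (\sum_j `|m j|) => x; rewrite OmE => -[j _ xj].
  by rewrite (le_trans (mP j x xj))// (le_trans (ler_norm _))// (bigD1 j)//= lerDl sumr_ge0.
have sOm u : u \in s -> [set` u.2] `<=` Om.
  by move=> us x xu; apply/Omhas; exact: sl us xu.
have prim u : exists ab : R * R, u \in s -> forall F f : R -> R,
    (forall x : R, is_derive x 1 F (f x)) -> continuous f ->
    \int[mu]_(x in [set` u.2]) f x = F ab.2 - F ab.1.
  have [us|us] := boolP (u \in s); last by exists (0, 0).
  have [a [b abP]] := Rintegral_itv_primitive (sub_oo _ (sOm u us)).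
  by exists (a, b).
have [ab abP] := choice prim.
exists ([seq (u.1, (ab u).2) | u <- s] ++ [seq (- u.1, (ab u).1) | u <- s]) => F f Ff fc.
have fi D : measurable D -> D `<=` Om -> mu.-integrable D (EFin \o f).
  by move=> mD DOm; apply: (@continuous_integrable _ M) => // x /DOm/OmM.
transitivity (\int[mu]_(x in Om) (\sum_(u <- s) u.1 * (f \_ [set` u.2]) x)).
  apply: eq_Rintegral => x /[1!inE] Omx.
  have /(congr1 (fun y => f x * y)) := sE x; rewrite (iffLR (Omhas x) Omx) mulr1 => {1}->.
  rewrite mulr_sumr; apply: eq_bigr => u _; rewrite mulrCA patchE mem_setE.
  by case: ifP; rewrite ?mulr1 ?mulr0.
rewrite Rintegral_lincomb//; last first.
  move=> u; rewrite (_ : EFin \o _ = (EFin \o f) \_ [set` u.2]).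
    by apply/integrable_restrict => //; apply: fi => //; exact: measurableI.
  by apply/funext => x; rewrite /= !patchE; case: ifP.
rewrite big_cat !big_map /= -big_split /= big_seq [RHS]big_seq; apply: eq_bigr => u us.
rewrite -Rintegral_mkcondr (_ : _ `&` _ = [set` u.2]); last by apply/setIidPr; exact: sOm.
by rewrite (abP u us F f)// mulrBr mulNr.
Qed.

End IntervalUnions.

(** * Inner products and orthonormal families for bounded functions *)

Section L2Geometry.
Context {R : realType}.
Notation mu := (@lebesgue_measure R).
Variable Om : set (measurableTypeR R).
Hypothesis mOm : measurable Om.
Hypothesis Om_fin : (mu Om < +oo)%E.

Let ReD (x y : R[i]) : complex.Re (x + y) = complex.Re x + complex.Re y.
Proof. by case: x y => ? ? [? ?]. Qed.
Let ImD (x y : R[i]) : complex.Im (x + y) = complex.Im x + complex.Im y.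
Proof. by case: x y => ? ? [? ?]. Qed.
Let ReM (x y : R[i]) :
  complex.Re (x * y) = complex.Re x * complex.Re y - complex.Im x * complex.Im y.
Proof. by case: x y => ? ? [? ?]. Qed.
Let ImM (x y : R[i]) :
  complex.Im (x * y) = complex.Re x * complex.Im y + complex.Im x * complex.Re y.
Proof. by case: x y => ? ? [? ?]. Qed.
Let ReJ (x : R[i]) : complex.Re x^* = complex.Re x. Proof. by case: x. Qed.
Let ImJ (x : R[i]) : complex.Im x^* = - complex.Im x. Proof. by case: x. Qed.

(** This class is closed under sums, products and conjugation, and its members are integrable
    because [Om] has finite measure. *)
Definition bounded_measurable (f : R -> R[i]) :=
  [/\ measurable_fun Om (fun x => complex.Re (f x)),
      measurable_fun Om (fun x => complex.Im (f x)) &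
      exists M : R, forall x, Om x -> `|complex.Re (f x)| <= M /\ `|complex.Im (f x)| <= M].

Lemma bounded_measurable_cst z : bounded_measurable (fun=> z).
Proof.
split; try exact: measurable_cst.
by exists (`|complex.Re z| + `|complex.Im z|) => x _; rewrite lerDl lerDr.
Qed.

Lemma bounded_measurableD f g : bounded_measurable f -> bounded_measurable g ->
  bounded_measurable (fun x => f x + g x).
Proof.
move=> [f1 f2 [M fM]] [g1 g2 [N gN]]; split.
- by under eq_fun do rewrite ReD; exact: measurable_funD.
- by under eq_fun do rewrite ImD; exact: measurable_funD.
- exists (M + N) => x Dx; have [f3 f4] := fM x Dx; have [g3 g4] := gN x Dx.
  by rewrite ReD ImD; split; rewrite (le_trans (ler_normD _ _))// lerD.
Qed.

Lemma bounded_measurableM f g : bounded_measurable f -> bounded_measurable g ->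
  bounded_measurable (fun x => f x * g x).
Proof.
move=> [f1 f2 [M fM]] [g1 g2 [N gN]]; split.
- under eq_fun do rewrite ReM.
  by apply: measurable_funB; exact: measurable_funM.
- under eq_fun do rewrite ImM.
  by apply: measurable_funD; exact: measurable_funM.
- exists (M * N + M * N) => x Dx; have [f3 f4] := fM x Dx; have [g3 g4] := gN x Dx.
  by rewrite ReM ImM; split; rewrite (le_trans (ler_normD _ _))// ?normrN !normrM lerD// ler_pM.
Qed.

Lemma bounded_measurableJ f : bounded_measurable f -> bounded_measurable (fun x => (f x)^*).
Proof.
move=> [f1 f2 [M fM]]; split.
- by under eq_fun do rewrite ReJ.
- by under eq_fun do rewrite ImJ; exact: measurableT_comp.
- by exists M => x Dx; rewrite ReJ ImJ normrN; exact: fM.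
Qed.

Lemma bounded_measurableB f g : bounded_measurable f -> bounded_measurable g ->
  bounded_measurable (fun x => f x - g x).
Proof.
move=> bf bg; apply: bounded_measurableD => //.
rewrite (_ : (fun _ => _) = (fun x => -1 * g x)); last by apply/funext => x; rewrite mulN1r.
by apply: bounded_measurableM => //; exact: bounded_measurable_cst.
Qed.

Lemma bounded_measurable_sum (U : eqType) (s : seq U) (c : U -> R[i]) (e : U -> R -> R[i]) :
  (forall i, i \in s -> bounded_measurable (e i)) ->
  bounded_measurable (fun x => \sum_(i <- s) c i * e i x).
Proof.
elim: s => [|i s IH] be.
  by under eq_fun do rewrite big_nil; exact: bounded_measurable_cst.
under eq_fun do rewrite big_cons; apply: bounded_measurableD.
  apply: bounded_measurableM; first exact: bounded_measurable_cst.
  by apply: be; rewrite mem_head.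
by apply: IH => j js; apply: be; rewrite inE js orbT.
Qed.

Lemma bounded_integrable (f : R -> R) (M : R) : measurable_fun Om f ->
  (forall x, Om x -> `|f x| <= M) -> mu.-integrable Om (EFin \o f).
Proof.
move=> mf fM; apply: measurable_bounded_integrable => //.
exists M; split; first exact: num_real.
by move=> x Mx y /= Omy; rewrite (le_trans (fM y Omy))// ltW.
Qed.

Lemma bounded_measurable_integrable f : bounded_measurable f ->
  mu.-integrable Om (EFin \o (fun x => complex.Re (f x))) /\
  mu.-integrable Om (EFin \o (fun x => complex.Im (f x))).
Proof.
by move=> [f1 f2 [M fM]]; split; apply: (@bounded_integrable _ M) => // x /fM[].
Qed.

Lemma CintegralD f g : bounded_measurable f -> bounded_measurable g ->
  Cintegral Om (fun x => f x + g x) = Cintegral Om f + Cintegral Om g.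
Proof.
move=> /bounded_measurable_integrable[f1 f2] /bounded_measurable_integrable[g1 g2].
rewrite /Cintegral; under eq_Rintegral do rewrite ReD.
under [X in _ +i* X]eq_Rintegral do rewrite ImD.
by rewrite !RintegralD.
Qed.

Lemma CintegralZ z f : bounded_measurable f ->
  Cintegral Om (fun x => z * f x) = z * Cintegral Om f.
Proof.
move=> /bounded_measurable_integrable[f1 f2].
rewrite /Cintegral; under eq_Rintegral do rewrite ReM.
under [X in _ +i* X]eq_Rintegral do rewrite ImM.
have fZ (r : R) (h : R -> R) : mu.-integrable Om (EFin \o h) ->
    mu.-integrable Om (EFin \o (fun x => r * h x)).
  by move=> hi; exact: (integrableZl mOm r hi).
rewrite RintegralB ?RintegralD ?RintegralZl//; try exact: fZ.
by case: z.
Qed.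

Lemma CintegralJ f : bounded_measurable f ->
  Cintegral Om (fun x => (f x)^*) = (Cintegral Om f)^*.
Proof.
move=> /bounded_measurable_integrable[f1 f2].
rewrite /Cintegral; under eq_Rintegral do rewrite ReJ.
under [X in _ +i* X]eq_Rintegral do rewrite ImJ -mulN1r.
by rewrite RintegralZl// mulN1r.
Qed.

Notation dot := (L2dot Om).

Lemma L2dotDl f g h : bounded_measurable f -> bounded_measurable g -> bounded_measurable h ->
  dot (fun x => f x + g x) h = dot f h + dot g h.
Proof.
move=> bf bg bh; rewrite /L2dot -CintegralD; first last.
- by apply: bounded_measurableM => //; exact: bounded_measurableJ.
- by apply: bounded_measurableM => //; exact: bounded_measurableJ.
by congr Cintegral; apply/funext => x; rewrite mulrDl.
Qed.

Lemma L2dotZl z f h : bounded_measurable f -> bounded_measurable h ->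
  dot (fun x => z * f x) h = z * dot f h.
Proof.
move=> bf bh; rewrite /L2dot -CintegralZ; first last.
  by apply: bounded_measurableM => //; exact: bounded_measurableJ.
by congr Cintegral; apply/funext => x; rewrite mulrA.
Qed.

Lemma L2dotC f g : bounded_measurable f -> bounded_measurable g -> dot f g = (dot g f)^*.
Proof.
move=> bf bg; rewrite /L2dot -CintegralJ; last first.
  by apply: bounded_measurableM => //; exact: bounded_measurableJ.
congr Cintegral; apply/funext => x.
by rewrite rmorphM/= conjcK mulrC.
Qed.

Lemma L2dotBl f g h : bounded_measurable f -> bounded_measurable g -> bounded_measurable h ->
  dot (fun x => f x - g x) h = dot f h - dot g h.
Proof.
move=> bf bg bh.
rewrite (_ : (fun x => f x - g x) = (fun x => f x + -1 * g x)); last first.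
  by apply/funext => x; rewrite mulN1r.
rewrite L2dotDl// ?L2dotZl ?mulN1r//.
by apply: bounded_measurableM => //; exact: bounded_measurable_cst.
Qed.

Lemma L2dot_suml (U : eqType) (s : seq U) (c : U -> R[i]) (e : U -> R -> R[i]) h :
  (forall i, i \in s -> bounded_measurable (e i)) -> bounded_measurable h ->
  dot (fun x => \sum_(i <- s) c i * e i x) h = \sum_(i <- s) c i * dot (e i) h.
Proof.
move=> + bh; elim: s => [|i s IH] be.
  rewrite big_nil -[RHS](mul0r (dot h h)) -L2dotZl//; congr L2dot; apply/funext => x.
  by rewrite big_nil mul0r.
have bi : bounded_measurable (e i) by apply: be; rewrite mem_head.
have bs j : j \in s -> bounded_measurable (e j) by move=> js; apply: be; rewrite inE js orbT.
rewrite big_cons -IH// -L2dotZl// -L2dotDl//; last 2 first.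
- by apply: bounded_measurableM => //; exact: bounded_measurable_cst.
- exact: bounded_measurable_sum.
by congr L2dot; apply/funext => x; rewrite big_cons.
Qed.

Lemma L2normsqE f : bounded_measurable f -> L2normsq Om f = (complex.Re (dot f f))%:E.
Proof.
move=> bf; have /bounded_measurable_integrable[fi _] :=
  bounded_measurableM bf (bounded_measurableJ bf).
rewrite /L2normsq /L2dot /Cintegral /= /Rintegral fineK; last first.
  exact: integrable_fin_num.
congr integral; apply/funext => x; congr EFin.
rewrite /=; case: (f x) => a b /=; rewrite sqr_sqrtr ?addr_ge0 ?sqr_ge0//.
by rewrite mulrN opprK !expr2.
Qed.

Lemma bounded_measurable_inL2 f : bounded_measurable f -> inL2 Om f.
Proof. by move=> bf; have [? ? _] := bf; split; rewrite // L2normsqE// ltry. Qed.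

Let normsqc (z : R[i]) : z * conjc z = ((ComplexField.Normc.normc z) ^+ 2)%:C.
Proof.
case: z => a b /=; rewrite sqr_sqrtr ?addr_ge0 ?sqr_ge0//.
by apply/eqP; rewrite eq_complex /= !expr2 mulrN opprK eqxx /= mulrN mulrC addNr.
Qed.

Let conjB (x y : R[i]) : conjc (x - y) = conjc x - conjc y. Proof. exact: rmorphB. Qed.
Let conjM (x y : R[i]) : conjc (x * y) = conjc x * conjc y. Proof. exact: rmorphM. Qed.
Let conj_sum (U : Type) (s : seq U) (F : U -> R[i]) :
  conjc (\sum_(i <- s) F i) = \sum_(i <- s) conjc (F i).
Proof. exact: rmorph_sum. Qed.

(** Completing the square in the coefficients. The choice [c i = dot f (e i)] yields Bessel's
    inequality; arbitrary [c] with small error yields the converse bound. *)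
Lemma L2_orthonormal_defect (U : eqType) (s : seq U) (c : U -> R[i]) (e : U -> R -> R[i])
    (f h : R -> R[i]) :
  uniq s -> (forall i, i \in s -> bounded_measurable (e i)) ->
  (forall i j, i \in s -> j \in s -> dot (e i) (e j) = (i == j)%:R) ->
  bounded_measurable f ->
  h = (fun x => f x - \sum_(i <- s) c i * e i x) ->
  complex.Re (dot h h) = complex.Re (dot f f)
    - \sum_(i <- s) (ComplexField.Normc.normc (dot f (e i))) ^+ 2
    + \sum_(i <- s) (ComplexField.Normc.normc (c i - dot f (e i))) ^+ 2.
Proof.
move=> us be oe bf hE; pose g x := \sum_(i <- s) c i * e i x.
have bg : bounded_measurable g by exact: bounded_measurable_sum.
have bh : bounded_measurable h by rewrite hE; exact: bounded_measurableB.
have gf : dot g f = \sum_(i <- s) c i * conjc (dot f (e i)).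
  rewrite L2dot_suml// big_seq [RHS]big_seq; apply: eq_bigr => i si.
  by rewrite -L2dotC//; exact: be.
have gg : dot g g = \sum_(i <- s) c i * conjc (c i).
  rewrite L2dot_suml// big_seq [RHS]big_seq; apply: eq_bigr => i si.
  rewrite (L2dotC (be i si) bg) L2dot_suml//; last exact: be.
  rewrite (bigD1_seq i)//= oe// eqxx mulr1 big_seq_cond big1 ?addr0//.
  by move=> j /andP[js ji]; rewrite oe// (negPf ji) mulr0.
suff : dot h h = dot f f - \sum_(i <- s) ((ComplexField.Normc.normc (dot f (e i))) ^+ 2)%:C
    + \sum_(i <- s) ((ComplexField.Normc.normc (c i - dot f (e i))) ^+ 2)%:C.
  by move=> ->; rewrite -!rmorph_sum -rmorphN !ReD.
have dB k : bounded_measurable k -> dot h k = dot f k - dot g k.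
  by rewrite hE; exact: L2dotBl.
rewrite (dB h)// (L2dotC bf bh) (L2dotC bg bh) (dB f)// (dB g)// !conjB.
rewrite -(L2dotC bf bf) -(L2dotC bg bg) -(L2dotC bf bg) -(L2dotC bg bf) gg.
rewrite (L2dotC bf bg) gf conj_sum.
rewrite -!addrA; congr (_ + _); rewrite opprB [X in _ + X]addrC.
rewrite -!sumrN -!big_split; apply: eq_bigr => i _; move: (dot f (e i)) => z.
by rewrite /= -[in RHS]normsqc -[in RHS]normsqc conjM conjcK conjB; ring.
Qed.

End L2Geometry.

(** * Exponentials, and the Bessel and Parseval relations of a spectral pair *)

Section ExponentialIntegrals.
Context {R : realType}.
Notation mu := (@lebesgue_measure R).
Notation normc := ComplexField.Normc.normc.

(** With [J] the whole of [Om] this is a basis element, with a smaller [J] a modulated indicator to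
    be expanded. *)
Definition truncated_exp (J : set R) (tau x : R) : R[i] :=
  expi (2 * pi * tau * x) * (\1_J x)%:C.

(** The Fourier transform of the indicator of [J], taken at -t. *)
Definition exp_integral (J : set R) (t : R) : R[i] :=
  Cintegral J (fun x => expi (2 * pi * t * x)).

Lemma expiDN (a b : R) : expi a * conjc (expi b) = expi (a - b).
Proof. by rewrite /expi cosB sinB; apply/eqP; rewrite eq_complex /=; apply/andP; split; apply/eqP; ring. Qed.

Lemma expi0 : expi (0 : R) = 1.
Proof. by rewrite /expi cos0 sin0. Qed.

Lemma continuous_cos_lin (w : R) : continuous (fun x => cos (w * x)).
Proof.
move=> x; apply: (@continuous_comp _ _ _ (fun x => w * x) cos); last exact: continuous_cos.
by apply: continuousM; [exact: cvg_cst|exact: cvg_id].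
Qed.

Lemma continuous_sin_lin (w : R) : continuous (fun x => sin (w * x)).
Proof.
move=> x; apply: (@continuous_comp _ _ _ (fun x => w * x) sin); last exact: continuous_sin.
by apply: continuousM; [exact: cvg_cst|exact: cvg_id].
Qed.

Lemma bounded_measurable_truncated_exp (Om J : set (measurableTypeR R)) tau :
  measurable Om -> measurable J -> bounded_measurable Om (truncated_exp J tau).
Proof.
move=> mOm mJ; apply: bounded_measurableM; split.
- by apply: measurable_funTS; apply: continuous_measurable_fun; exact: continuous_cos_lin.
- by apply: measurable_funTS; apply: continuous_measurable_fun; exact: continuous_sin_lin.
- by exists 1 => x _ /=; rewrite cos_max sin_max.
- exact: measurable_indic.
- exact: measurable_cst.
- exists 1 => x _ /=; rewrite normr0 ler01; split => //.
  by rewrite indicE; case: (_ \in _); rewrite ?normr1 ?normr0.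
Qed.

Lemma dot_truncated_exp (Om J K : set (measurableTypeR R)) tau lam :
  J `<=` K -> J `<=` Om ->
  L2dot Om (truncated_exp J tau) (truncated_exp K lam) = exp_integral J (tau - lam).
Proof.
move=> JK JOm; rewrite /L2dot /exp_integral /Cintegral.
have E x : truncated_exp J tau x * (truncated_exp K lam x)^* =
    expi (2 * pi * (tau - lam) * x) * (\1_J x)%:C.
  rewrite [X in _ * X](_ : _ = conjc (truncated_exp K lam x))//.
  have -> : 2 * pi * (tau - lam) * x = 2 * pi * tau * x - 2 * pi * lam * x by ring.
  rewrite -expiDN /truncated_exp !indicE.
  have [xJ|xJ] := boolP (x \in J); last by rewrite rmorph0 !mulr0 mul0r.
  by rewrite (mem_set (JK x (set_mem xJ))) rmorph1 !mulr1.
have DJ (g : R -> R) : \int[mu]_(x in J) g x = \int[mu]_(x in Om) (g \_ J) x.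
  by rewrite -Rintegral_mkcondr; congr Rintegral; symmetry; apply/setIidPr.
rewrite !DJ; congr (_ +i* _); apply: eq_Rintegral => x _; rewrite E patchE indicE.
  by case: (x \in J); rewrite ?mulr1 ?mulr0.
by case: (x \in J); rewrite ?mulr1 ?mulr0.
Qed.

Lemma exp_integral0 (J : set (measurableTypeR R)) : measurable J ->
  exp_integral J 0 = (fine (mu J))%:C.
Proof.
move=> mJ; rewrite /exp_integral (_ : (fun _ => _) = fun=> 1); last first.
  by apply/funext => x; rewrite mulr0 mul0r expi0.
by rewrite /Cintegral /= !Rintegral_cst// mul1r mul0r.
Qed.

Section SpectralPair.
Variables (Om : set (measurableTypeR R)) (Lam : set R).
Hypotheses (mOm : measurable Om) (Om1 : mu Om = 1%E) (sp : spectral_pair Om Lam).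

Lemma exp_funE lam : exp_fun Om lam = truncated_exp Om lam.
Proof.
by apply/funext => x; rewrite /exp_fun Om1 /= sqrtr1 invr1 rmorph1 mul1r.
Qed.

Lemma exp_integral_spectrum a b : Lam a -> Lam b -> a != b -> exp_integral Om (a - b) = 0.
Proof.
case: sp => _ o _ La Lb /negPf ab; have := o a b La Lb.
by rewrite !exp_funE dot_truncated_exp// ab.
Qed.

Let Om_fin : (mu Om < +oo)%E. Proof. by rewrite Om1 ltry. Qed.

Let expb lam : bounded_measurable Om (truncated_exp Om lam).
Proof. exact: bounded_measurable_truncated_exp. Qed.

Let expo i j : Lam i -> Lam j ->
  L2dot Om (truncated_exp Om i) (truncated_exp Om j) = (i == j)%:R.
Proof. by case: sp => _ o _ Li Lj; rewrite -!exp_funE; exact: o. Qed.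

Variables (J : set (measurableTypeR R)) (tau : R).
Hypotheses (mJ : measurable J) (JOm : J `<=` Om).

Let fb : bounded_measurable Om (truncated_exp J tau).
Proof. exact: bounded_measurable_truncated_exp. Qed.

Lemma spectral_bessel (s : seq R) : uniq s -> (forall i, i \in s -> Lam i) ->
  \sum_(i <- s) normc (exp_integral J (tau - i)) ^+ 2 <= fine (mu J).
Proof.
move=> us sL.
pose h x := truncated_exp J tau x -
  \sum_(i <- s) exp_integral J (tau - i) * truncated_exp Om i x.
have h0 : 0 <= complex.Re (L2dot Om h h).
  rewrite -lee_fin -L2normsqE//; first by apply: integral_ge0 => x _; rewrite lee_fin sqr_ge0.
  by apply: bounded_measurableB => //; exact: bounded_measurable_sum.
have := L2_orthonormal_defect mOm Om_fin us (fun i _ => expb i)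
  (fun i j si sj => expo (sL i si) (sL j sj)) fb (erefl h).
rewrite [X in _ + X]big1; last first.
  by move=> i _; rewrite dot_truncated_exp// subrr ComplexField.Normc.normc0 expr0n.
rewrite addr0 dot_truncated_exp// subrr exp_integral0//.
under eq_bigr do rewrite dot_truncated_exp//.
by move=> hE; rewrite hE in h0; rewrite -subr_ge0.
Qed.

(** Density gives an approximation with squared error below [eps], and by the defect formula the
    Fourier coefficients do at least as well. *)
Lemma spectral_parseval_le (eps : R) : 0 < eps ->
  exists s : seq R, [/\ uniq s, (forall i, i \in s -> Lam i) &
    fine (mu J) - eps < \sum_(i <- s) normc (exp_integral J (tau - i)) ^+ 2].
Proof.
move=> e0; case: sp => _ _ /(_ (truncated_exp J tau) (Num.sqrt eps)).
rewrite sqrtr_gt0 sqr_sqrtr ?ltW//.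
have fL2 : inL2 Om (truncated_exp J tau) by exact: bounded_measurable_inL2.
move=> /(_ fL2 e0)[s [c [sL hn]]]; exists (undup s); split; first exact: undup_uniq.
  by move=> i; rewrite mem_undup; exact: sL.
move: hn; have uL i : i \in undup s -> Lam i by rewrite mem_undup; exact: sL.
(* The approximating list may repeat a frequency; the repeated terms are merged before
   orthonormality is applied. *)
pose c' i := c i *+ count_mem i s.
pose h x := truncated_exp J tau x - \sum_(i <- undup s) c' i * truncated_exp Om i x.
have bh : bounded_measurable Om h.
  by apply: bounded_measurableB => //; exact: bounded_measurable_sum.
have -> : (fun x => truncated_exp J tau x - \sum_(i <- s) c i * exp_fun Om i x) = h.
  apply/funext => x; congr (_ - _); rewrite -big_undup_iterop_count.
  by apply: eq_bigr => i _; rewrite exp_funE /c' mulrnAl.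
rewrite (L2normsqE mOm Om_fin bh) lte_fin.
rewrite (L2_orthonormal_defect mOm Om_fin (undup_uniq s) (fun i _ => expb i)
  (fun i j si sj => expo (uL i si) (uL j sj)) fb (erefl h)).
rewrite dot_truncated_exp// subrr exp_integral0//.
rewrite [X in _ - X](eq_bigr (fun i => normc (exp_integral J (tau - i)) ^+ 2)); last first.
  by move=> i _; rewrite dot_truncated_exp.
rewrite [complex.Re _]/=; set S' := (X in _ - _ + X < _) => ltS.
have : 0 <= S' by apply: sumr_ge0 => i _; rewrite sqr_ge0.
by move: ltS; lra.
Qed.

End SpectralPair.
End ExponentialIntegrals.

(** * Sums of inverse squares over separated points *)

Section SeparatedSums.
Context {R : realType}.

(* [1/y^2 <= (1/(y - d) - 1/y)/d], so the sum telescopes. *)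
Lemma sum_invsqr_path (d y0 : R) (s : seq R) : 0 < d -> 0 < y0 ->
  path (fun u v => u + d <= v) y0 s -> \sum_(y <- s) y ^- 2 <= (d * y0)^-1.
Proof.
move=> d0; elim: s y0 => [|y s IH] y0 y00 /=.
  by rewrite big_nil invr_ge0 mulr_ge0// ltW.
move=> /andP[yy0 /IH]; have ygt : 0 < y by apply: lt_le_trans yy0; rewrite addr_gt0.
move=> /(_ ygt) sle; rewrite big_cons; apply: (le_trans (lerD (lexx _) sle)).
have -> : y ^- 2 + (d * y)^-1 = (d + y) / (d * y ^+ 2).
  by field; rewrite !gt_eqF.
rewrite ler_pdivrMr ?mulr_gt0 ?exprn_gt0// mulrC ler_pdivlMr ?mulr_gt0//.
have : 0 <= (y - d - y0) * (d + y).
  by apply: mulr_ge0; [rewrite subr_ge0 lerBrDr|rewrite addr_ge0// ltW].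
have -> : (d + y) * (d * y0) = d * ((d + y) * y0) by ring.
by rewrite ler_pM2l// => h; nra.
Qed.

(** Sorting turns pairwise separation into gaps between consecutive points. *)
Lemma sum_invsqr_pos (d y0 : R) (s : seq R) : 0 < d -> 0 < y0 -> uniq s ->
  (forall y, y \in s -> y0 + d <= y) ->
  (forall y z, y \in s -> z \in s -> y != z -> d <= `|y - z|) ->
  \sum_(y <- s) y ^- 2 <= (d * y0)^-1.
Proof.
move=> d0 y00 us sy ssep.
have ps : perm_eq s (sort <=%R s) by rewrite perm_sym perm_sort.
rewrite (perm_big _ ps) /=.
apply: sum_invsqr_path => //.
rewrite path_min_sorted; last by apply/allP => y; rewrite mem_sort; exact: sy.
apply: (@sub_in_sorted _ (mem s) <%R); last by rewrite sort_lt_sorted.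
  move=> y z ys zs yz; have := ssep _ _ ys zs (negbT (lt_eqF yz)).
  by rewrite distrC gtr0_norm ?subr_gt0// lerBrDl.
by apply/allP => y; rewrite mem_sort.
Qed.

Lemma sum_invsqr_separated (d y0 : R) (s : seq R) : 0 < d -> 0 < y0 -> uniq s ->
  (forall y, y \in s -> y0 + d <= `|y|) ->
  (forall y z, y \in s -> z \in s -> y != z -> d <= `|y - z|) ->
  \sum_(y <- s) y ^- 2 <= 2 * (d * y0)^-1.
Proof.
move=> d0 y00 us sy ssep; rewrite (bigID (fun y => 0 <= y)) /=.
rewrite mulr_natl mulr2n; apply: lerD.
  rewrite -big_filter; apply: sum_invsqr_pos => //; first exact: filter_uniq.
    by move=> y; rewrite mem_filter => /andP[yge /sy]; rewrite ger0_norm.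
  move=> y z; rewrite !mem_filter => /andP[_ ys] /andP[_ zs]; exact: ssep.
rewrite -big_filter; set s' := [seq _ <- s | _].
have -> : \sum_(y <- s') y ^- 2 = \sum_(y <- [seq - y | y <- s']) y ^- 2.
  by rewrite big_map; apply: eq_bigr => y _; rewrite sqrrN.
apply: sum_invsqr_pos => //; first by rewrite map_inj_uniq ?filter_uniq//; exact: oppr_inj.
  move=> _ /mapP[y + ->]; rewrite mem_filter -ltNge => /andP[y_lt /sy].
  by rewrite ltr0_norm.
move=> _ _ /mapP[y + ->] /mapP[z + ->]; rewrite !mem_filter => /andP[_ ys] /andP[_ zs].
by rewrite eqr_opp -opprD normrN; exact: ssep.
Qed.

Lemma nonzero_norm_lower_bound (s : seq R) :
  exists2 d : R, 0 < d <= 1 & forall z, z \in s -> z != 0 -> d <= `|z|.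
Proof.
elim: s => [|z s [d /andP[d0 d1] ds]]; first by exists 1; rewrite ?ltr01 ?lexx.
have [z0|z0] := eqVneq z 0.
  by exists d; rewrite ?d0// => y /[!inE] /predU1P[->|/ds//]; rewrite z0 eqxx.
exists (Num.min d `|z|); first by rewrite lt_min d0 normr_gt0 z0 ge_min d1.
move=> y /[!inE] /predU1P[-> _|/ds h /h dy]; first by rewrite ge_min lexx orbT.
by rewrite ge_min dy.
Qed.

End SeparatedSums.

(** * Separation, local rule and periodicity of the spectrum *)

Section IntervalSpectrum.
Context {R : realType}.
Notation mu := (@lebesgue_measure R).
Notation normc := ComplexField.Normc.normc.
Variables (Om : set (measurableTypeR R)) (Lam : set R).
Hypotheses (mOm : measurable Om) (Om1 : mu Om = 1%E) (sp : spectral_pair Om Lam).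
Variable s : seq (R * R).
Hypothesis srep : forall F f : R -> R,
    (forall x : R, is_derive x 1 F (f x)) -> continuous f ->
    \int[mu]_(x in Om) f x = \sum_(u <- s) u.1 * F u.2.

(* [cos_sum t + i sin_sum t] is the function E(t). *)
Definition cos_sum t : R := \sum_(u <- s) u.1 * cos (2 * pi * u.2 * t).
Definition sin_sum t : R := \sum_(u <- s) u.1 * sin (2 * pi * u.2 * t).

(** Unlike the vanishing of [exp_integral Om t], this also holds at [t = 0], so a frequency may be
    compared with itself. *)
Definition orthogonal_diff t := cos_sum t = 0 /\ sin_sum t = 0.

Lemma sum_weights0 : \sum_(u <- s) u.1 = 0.
Proof.
have := @srep (fun=> 1) (fun=> 0).
rewrite Rintegral_cst// mul0r => h.
transitivity (\sum_(u <- s) u.1 * 1); first by apply: eq_bigr => u _; rewrite mulr1.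
by rewrite -h// => x; exact: cvg_cst.
Qed.

(** The primitive [id] of 1 computes the measure of [Om]. This nonzero moment is what
    [trig_zeros_finite] requires. *)
Lemma sum_moments1 : \sum_(u <- s) u.1 * u.2 = 1.
Proof.
have := @srep id (fun=> 1).
rewrite Rintegral_cst// [X in fine X](_ : _ = 1%E) ?mul1r; last exact: Om1.
move=> h.
by rewrite -h// => x; exact: cvg_cst.
Qed.

Lemma exp_integral_sums t : t != 0 ->
  exp_integral Om t = (sin_sum t / (2 * pi * t)) +i* (- (cos_sum t / (2 * pi * t))).
Proof.
move=> t0; have w0 : 2 * pi * t != 0 :> R by rewrite !mulf_neq0// gt_eqF// pi_gt0.
set w := 2 * pi * t in w0 *.
have Dsin (x : R) : is_derive x 1 (fun x => sin (w * x) / w) (cos (w * x)).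
  by apply: is_derive_eq; rewrite /GRing.scale /= mulr1; field.
have Dcos (x : R) : is_derive x 1 (fun x => - cos (w * x) / w) (sin (w * x)).
  by apply: is_derive_eq; rewrite /GRing.scale /= mulr1; field.
rewrite /exp_integral /Cintegral /=; congr (_ +i* _).
  rewrite (srep Dsin (@continuous_cos_lin R w)) /sin_sum mulr_suml.
  by apply: eq_bigr => u _; rewrite mulrA /w; congr (_ * sin _ / _); ring.
rewrite (srep Dcos (@continuous_sin_lin R w)) /cos_sum mulr_suml -sumrN.
apply: eq_bigr => u _; rewrite mulrA mulrN mulNr /w.
by congr (- (_ * cos _ / _)); ring.
Qed.

Lemma exp_integral_eq0 t : t != 0 -> exp_integral Om t = 0 <-> orthogonal_diff t.
Proof.
move=> t0; have w0 : 2 * pi * t != 0 :> R by rewrite !mulf_neq0// gt_eqF// pi_gt0.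
rewrite exp_integral_sums//; split => [[/eqP + /eqP]|[-> ->]]; last by rewrite mul0r oppr0.
by rewrite oppr_eq0 !mulf_eq0 invr_eq0 (negPf w0) !orbF => /eqP ? /eqP.
Qed.

Lemma orthogonal_diff0 : orthogonal_diff 0.
Proof.
split; rewrite /cos_sum /sin_sum.
  by under eq_bigr do rewrite mulr0 cos0 mulr1; exact: sum_weights0.
by rewrite big1// => u _; rewrite mulr0 sin0 mulr0.
Qed.

Lemma spectrum_orthogonal_diff a b : Lam a -> Lam b -> orthogonal_diff (a - b).
Proof.
move=> La Lb; have [->|ab] := eqVneq a b; first by rewrite subrr; exact: orthogonal_diff0.
have ab0 : a - b != 0 by rewrite subr_eq0.
by apply/(exp_integral_eq0 ab0); exact: (exp_integral_spectrum Om1 sp).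
Qed.

Lemma finite_orthogonal_diff (L : nat) :
  exists zs : seq R, forall t, orthogonal_diff t -> `|t| <= L%:R -> t \in zs.
Proof.
have := @trig_zeros_finite R (size s) (fun j => (tnth (in_tuple s) j).1)
  (fun j => 2 * pi * (tnth (in_tuple s) j).2) L%:R.
have -> : \sum_(j < size s) (tnth (in_tuple s) j).1 * (2 * pi * (tnth (in_tuple s) j).2) = 2 * pi.
  transitivity (2 * pi * \sum_(u <- s) u.1 * u.2); last by rewrite sum_moments1 mulr1.
  by rewrite [in RHS]big_tnth mulr_sumr; apply: eq_bigr => j _; ring.
rewrite mulf_neq0// ?gt_eqF ?pi_gt0// => /(_ isT)/finite_seqP[zs zsE].
exists zs => t [tc ts] tL.
suff : [set` zs] t by [].
rewrite -zsE; split => //; first by rewrite -[RHS]tc /cos_sum [RHS]big_tnth.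
by rewrite -[RHS]ts /sin_sum [RHS]big_tnth.
Qed.

Lemma spectrum_separated : exists2 d : R, 0 < d &
  forall a b, Lam a -> Lam b -> a != b -> d <= `|a - b|.
Proof.
have [zs zsP] := finite_orthogonal_diff 1.
have [d /andP[d0 d1] dP] := nonzero_norm_lower_bound zs.
exists d => // a b La Lb ab; have [ab1|/ltW] := leP `|a - b| 1; last exact: le_trans.
by apply: dP; [apply: zsP => //; exact: spectrum_orthogonal_diff|rewrite subr_eq0].
Qed.

Lemma exp_integral_decay : exists2 K : R, 0 <= K &
  forall t, t != 0 -> normc (exp_integral Om t) ^+ 2 <= K * t ^- 2.
Proof.
pose B := \sum_(u <- s) `|u.1|.
have bnd (g : R -> R) : (forall x, `|g x| <= 1) -> forall w,
    (\sum_(u <- s) u.1 * g (w u)) ^+ 2 <= B ^+ 2.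
  move=> g1 w; rewrite -real_normK ?num_real// lerXn2r ?nnegrE ?sumr_ge0//.
  rewrite (le_trans (ler_norm_sum _ _ _))//; apply: ler_sum => u _.
  by rewrite normrM ler_piMr.
exists (2 * B ^+ 2 / (2 * pi) ^+ 2) => [|t t0].
  by rewrite divr_ge0 ?sqr_ge0// mulr_ge0 ?sqr_ge0.
rewrite exp_integral_sums//= sqr_sqrtr ?addr_ge0 ?sqr_ge0// sqrrN !expr_div_n -mulrDl.
rewrite exprMn invfM mulrA ler_wpM2r ?invr_ge0 ?sqr_ge0//.
rewrite ler_wpM2r ?invr_ge0 ?sqr_ge0// mulr_natl mulr2n.
by apply: lerD; apply: bnd => x; [exact: sin_max|exact: cos_max].
Qed.

(** Were [y] outside the spectrum, Parseval for its exponential, of norm 1, would give squared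
    coefficients with sum above 1/2 on a finite set. Those within [T] of [y] vanish; decay and
    separation make the others too small. *)
Lemma spectrum_local_rule : exists2 T : R, 0 <= T & forall y,
  (forall a, Lam a -> `|a - y| <= T -> orthogonal_diff (y - a)) -> Lam y.
Proof.
have [d d0 dP] := spectrum_separated.
have [K K0 KP] := exp_integral_decay.
(* Then [d * y0 = 4 * K + d], and the tail is at most [2 * K / (4 * K + d)], below 1/2. *)
pose y0 := 4 * K / d + 1.
have y00 : 0 < y0 by rewrite ltr_wpDl// divr_ge0 ?mulr_ge0// ltW.
exists (y0 + d); first by rewrite addr_ge0 ?ltW.
move=> y yorth; apply: contrapT => nLy.
have [|r [ur rL]] := spectral_parseval_le mOm Om1 sp y mOm (@subset_refl _ Om) (eps := 2^-1).
  by rewrite invr_gt0.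
rewrite Om1 [fine _]/=; apply/negP; rewrite -leNgt.
pose r' := [seq a <- r | ~~ (`|a - y| <= y0 + d)].
have -> : \sum_(a <- r) normc (exp_integral Om (y - a)) ^+ 2 =
    \sum_(a <- r') normc (exp_integral Om (y - a)) ^+ 2.
  rewrite big_filter [RHS]big_mkcond big_seq [RHS]big_seq; apply: eq_bigr => a ar.
  case: ifPn => // /negPn ay; rewrite (_ : exp_integral _ _ = 0).
    by rewrite ComplexField.Normc.normc0 expr0n.
  have ya0 : y - a != 0.
    by rewrite subr_eq0; apply/eqP => ya; apply: nLy; rewrite ya; exact: rL.
  by apply/(exp_integral_eq0 ya0); apply: yorth => //; exact: rL.
have r'P a : a \in r' -> a \in r /\ y0 + d < `|a - y|.
  by rewrite mem_filter -ltNge => /andP[].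
apply: (@le_trans _ _ (\sum_(a <- r') K * (y - a) ^- 2)).
  rewrite big_seq [leRHS]big_seq; apply: ler_sum => a /r'P[_ ay]; apply: KP.
  by rewrite -normr_gt0 distrC (lt_trans _ ay)// addr_gt0.
rewrite -mulr_sumr.
have : \sum_(a <- r') (y - a) ^- 2 <= 2 * (d * y0)^-1.
  have -> : \sum_(a <- r') (y - a) ^- 2 = \sum_(a <- [seq y - a | a <- r']) a ^- 2.
    by rewrite big_map.
  apply: sum_invsqr_separated => //.
  - rewrite map_inj_uniq ?filter_uniq// => a b /addrI; exact: oppr_inj.
  - by move=> _ /mapP[a /r'P[_ ay] ->]; rewrite distrC ltW.
  - move=> _ _ /mapP[a /r'P[ar _] ->] /mapP[b /r'P[br _] ->] ab.
    have -> : y - a - (y - b) = b - a by ring.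
    by apply: dP; [exact: rL|exact: rL|apply: contra ab => /eqP ->].
move=> /(ler_wpM2l K0)/le_trans; apply.
have -> : d * y0 = 4 * K + d by rewrite /y0; field; rewrite gt_eqF.
rewrite mulrA ler_pdivrMr; last by rewrite ltr_wpDl// mulr_ge0.
by lra.
Qed.

(** The rows hold the real and imaginary parts of the numbers exp(2 pi i xi_j a), so spans are taken
    over the reals. *)
Definition phase_vector (a : R) : 'M[R]_(2, size s) :=
  \matrix_(i, j) (if i == 0 then cos (2 * pi * (tnth (in_tuple s) j).2 * a)
                  else sin (2 * pi * (tnth (in_tuple s) j).2 * a)).

(** By the subtraction formulas, [cos_sum (y - a)] and [sin_sum (y - a)] are linear in the phase
    vector of [a]. *)
Lemma orthogonal_diff_span y (r : seq R) a :
  phase_vector a \in <<map phase_vector r>>%VS ->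
  (forall z, z \in r -> orthogonal_diff (y - z)) -> orthogonal_diff (y - a).
Proof.
move=> aspan ry; have := @coord_span _ _ _ (in_tuple (map phase_vector r)) _ aspan.
set k := fun i => coord (in_tuple (map phase_vector r)) i (phase_vector a) => aE.
pose w j := 2 * pi * (tnth (in_tuple s) j).2.
have rE (i : 'I_(size (map phase_vector r))) :
    (in_tuple (map phase_vector r))`_i = phase_vector r`_i.
  by rewrite (nth_map 0)// -[size r](size_map phase_vector).
have cosE j : cos (w j * a) = \sum_i k i * cos (w j * r`_i).
  have := congr1 (fun A : 'M[R]_(2, size s) => A 0 j) aE; rewrite summxE mxE /= => ->.
  by apply: eq_bigr => i _; rewrite mxE rE mxE.
have sinE j : sin (w j * a) = \sum_i k i * sin (w j * r`_i).
  have := congr1 (fun A : 'M[R]_(2, size s) => A 1 j) aE; rewrite summxE mxE /= => ->.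
  by apply: eq_bigr => i _; rewrite mxE rE mxE.
have ryi (i : 'I_(size (map phase_vector r))) : orthogonal_diff (y - r`_i).
  by apply: ry; rewrite mem_nth// -[size r](size_map phase_vector).
split.
  transitivity (\sum_i k i * cos_sum (y - r`_i)).
    under [RHS]eq_bigr do rewrite /cos_sum mulr_sumr.
    rewrite exchange_big /cos_sum [LHS]big_tnth [RHS]big_tnth; apply: eq_bigr => j _.
    rewrite -/(w j) mulrBr cosB cosE sinE !mulr_sumr -big_split mulr_sumr.
    by apply: eq_bigr => i _ /=; rewrite mulrBr cosB; ring.
  by rewrite big1// => i _; have [-> _] := ryi i; rewrite mulr0.
transitivity (\sum_i k i * sin_sum (y - r`_i)).
  under [RHS]eq_bigr do rewrite /sin_sum mulr_sumr.
  rewrite exchange_big /sin_sum [LHS]big_tnth [RHS]big_tnth; apply: eq_bigr => j _.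
  rewrite -/(w j) mulrBr sinB cosE sinE !mulr_sumr -sumrB mulr_sumr.
  by apply: eq_bigr => i _ /=; rewrite [in RHS]mulrBr sinB; ring.
by rewrite big1// => i _; have [_ ->] := ryi i; rewrite mulr0.
Qed.

Lemma spectrum_periodic : exists2 p : R, 0 < p & forall x, Lam x <-> Lam (x + p).
Proof.
have [T T0 TP] := spectrum_local_rule.
exact: (local_rule_periodic T0 orthogonal_diff_span finite_orthogonal_diff
  spectrum_orthogonal_diff TP).
Qed.

End IntervalSpectrum.

(** * The period equals the number of cosets *)

Section IntegerPeriod.
Context {R : realType}.
Notation mu := (@lebesgue_measure R).
Notation normc := ComplexField.Normc.normc.

Lemma periodic_int (Lam : set R) (p : R) : (forall x, Lam x <-> Lam (x + p)) ->
  forall (k : int) x, Lam x <-> Lam (x + p * k%:~R).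
Proof.
move=> pP; have pn (n : nat) x : Lam x <-> Lam (x + p * n%:R).
  elim: n => [|n IH]; first by rewrite mulr0 addr0.
  by rewrite IH pP -addrA -natr1 mulrDr mulr1.
move=> [n|n] x; first by rewrite -pmulrn.
by rewrite NegzE mulrNz mulrN -pmulrn (pn n.+1 (x - _)) subrK.
Qed.

Lemma sum_uniq_sub (r s : seq R) (F : R -> R) : uniq r -> uniq s -> {subset r <= s} ->
  (forall x, 0 <= F x) -> \sum_(x <- r) F x <= \sum_(x <- s) F x.
Proof.
move=> ur us rs F0.
have rE : perm_eq r [seq x <- s | x \in r].
  apply: uniq_perm => //; first exact: filter_uniq.
  by move=> x; rewrite mem_filter andb_idr//; exact: rs.
rewrite (perm_big _ rE) /= big_filter big_mkcond /=.
by apply: ler_sum => x _; case: ifP.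
Qed.

Lemma exp_integral_segment (a h t : R) : 0 < h -> t != 0 ->
  normc (exp_integral `[a, a + h] t) ^+ 2 = (sin (pi * h * t) / (pi * t)) ^+ 2.
Proof.
move=> h0 t0; have w0 : 2 * pi * t != 0 :> R by rewrite !mulf_neq0// gt_eqF// pi_gt0.
have wE : 2 * pi * t * (a + h) = 2 * pi * t * a + (pi * h * t) *+ 2 by ring.
have piE : pi * t = (2 * pi * t) / 2 by field.
set w := 2 * pi * t in w0 wE piE *.
have Dsin (x : R) : is_derive x 1 (fun x => sin (w * x) / w) (cos (w * x)).
  by apply: is_derive_eq; rewrite /GRing.scale /= mulr1; field.
have Dcos (x : R) : is_derive x 1 (fun x => - cos (w * x) / w) (sin (w * x)).
  by apply: is_derive_eq; rewrite /GRing.scale /= mulr1; field.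
have aah : a < a + h by rewrite ltrDl.
rewrite /exp_integral /Cintegral /=.
rewrite (Rintegral_segment_primitive aah Dsin (@continuous_cos_lin R w)).
rewrite (Rintegral_segment_primitive aah Dcos (@continuous_sin_lin R w)).
rewrite sqr_sqrtr ?addr_ge0 ?sqr_ge0// piE wE.
set b := pi * h * t; rewrite (sinD (w * a)) (cosD (w * a)) sin_mulr2n cos_mulr2n.
have cs := cos2Dsin2 (w * a); have cb := cos2sin2 b.
set S := sin (w * a) in cs *; set C := cos (w * a) in cs *.
set sb := sin b in cb *; set B := cos b in cb *.
(* Once cos 2b is written as 1 - 2 sin^2 b, the sum of squares factors by the two-square identity;
   both brackets equal 1. *)
transitivity (4 * sb ^+ 2 * (C ^+ 2 + S ^+ 2) * (sb ^+ 2 + B ^+ 2) / w ^+ 2).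
  have -> : B ^+ 2 *+ 2 - 1 = 1 - sb ^+ 2 *+ 2 by rewrite cb; ring.
  by field.
by rewrite cs cb; field.
Qed.

Variables (Om : set (measurableTypeR R)) (Lam : set R).
Hypotheses (mOm : measurable Om) (Om1 : mu Om = 1%E) (sp : spectral_pair Om Lam).
Variables (p d0 a : R).
Hypotheses (p_gt0 : 0 < p) (pP : forall x, Lam x <-> Lam (x + p)).
Hypotheses (d0_gt0 : 0 < d0)
  (d0P : forall x y, Lam x -> Lam y -> x != y -> d0 <= `|x - y|).
Hypothesis segOm : [set` `[a, a + p^-1]] `<=` Om.

(** With length [p^-1], translating [t] by [p] only changes the sign of [sin (pi * h * t)], so its
    square is constant on cosets. *)
Let J : set (measurableTypeR R) := `[a, a + p^-1]%classic.
Let h : R := p^-1.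

Let muJ : fine (mu J) = h.
Proof.
rewrite /J lebesgue_measure_itv /= lte_fin ltrDl invr_gt0 p_gt0 -EFinD /=.
by rewrite addrC addKr.
Qed.

(* Used as modulation frequency, such a point keeps [tau - x] away from 0, where
   [exp_integral_segment] divides by 0. *)
Lemma avoiding_point : exists tau, ~ Lam tau.
Proof.
have [L0|L0] := pselect (Lam 0); last by exists 0.
(* The points 0 and [d0 / 2] are too close to belong both to [Lam]. *)
exists (d0 / 2) => Ld; have d2 : d0 / 2 != 0 by rewrite mulf_neq0 ?gt_eqF// invr_gt0.
by have := d0P Ld L0 d2; rewrite subr0 gtr0_norm ?divr_gt0//; have := d0_gt0; lra.
Qed.

Section Representatives.
Variables (tau : R) (ls : seq R).
Hypotheses (tauL : ~ Lam tau) (uls : uniq ls)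
  (lsP : forall x, x \in ls <-> Lam x /\ tau <= x < tau + p).

(** For [k < 2 ^ m.+1] the multiples of [p] added to [l] run from [- 2 ^ m] to [2 ^ m - 1], a dyadic
    block fit for [cosecant_sqr_partial_sum]. *)
Let pt (m : nat) (l : R) (k : nat) : R := l - p * 2 ^+ m + p * k%:R.
Let pts (m : nat) := [seq pt m l k | l <- ls, k <- iota 0 (2 ^ m.+1)].

Let lsL l : l \in ls -> Lam l. Proof. by move=> /lsP[]. Qed.

Let ls_itv l : l \in ls -> 0 < l - tau < p.
Proof.
move=> ll; have [Ll /andP[l1 l2]] := (lsP l).1 ll.
rewrite subr_gt0 ltrBlDl l2 andbT lt_neqAle l1 andbT.
by apply/eqP => tl; apply: tauL; rewrite tl.
Qed.

Lemma representative x : Lam x -> exists2 l, l \in ls &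
  x = l + p * (Num.floor ((x - tau) / p))%:~R.
Proof.
move=> Lx; set k := Num.floor _; exists (x - p * k%:~R); last by rewrite subrK.
apply/lsP; split.
  by have := (periodic_int pP (- k) x).1 Lx; rewrite mulrNz mulrN.
have := floor_itv ((x - tau) / p); rewrite -/k intrD => /andP[].
rewrite ler_pdivlMr// ltr_pdivrMr// mulrDl mul1r (mulrC p) => k1 k2.
by apply/andP; split; lra.
Qed.

Let ptL m l k : l \in ls -> Lam (pt m l k).
Proof.
move=> /lsL Ll; rewrite /pt -addrA -mulrN -mulrDr.
have -> : - 2 ^+ m + k%:R = (k%:Z - (2 ^ m)%N%:Z)%:~R :> R.
  by rewrite intrB -!pmulrn natrX addrC.
exact: (periodic_int pP _ l).1.
Qed.

Let pts_uniq m : uniq (pts m).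
Proof.
apply: allpairs_uniq => //; first exact: iota_uniq.
move=> [l k] [l' k'] /allpairsP[[l1 k1] /= [ll _ [-> ->]]] /allpairsP[[l2 k2] /= [ll' _ [-> ->]]].
rewrite /= /pt => e; have /andP[i1 i2] := ls_itv ll; have /andP[i3 i4] := ls_itv ll'.
have e2 : l1 - l2 = p * (k2%:R - k1%:R) by rewrite mulrBr; lra.
(* Both representatives lie in an interval of length [p]. *)
have : `|k2%:R - k1%:R : R| < 1.
  rewrite -(ltr_pM2l p_gt0) mulr1 -{1}(gtr0_norm p_gt0) -normrM -e2.
  by rewrite ltr_norml; apply/andP; split; lra.
rewrite ltr_distl => /andP[].
rewrite ltrBlDr !natr1 !ltr_nat !ltnS => k12 k21.
have kk : k1 = k2 by apply/eqP; rewrite eqn_leq k12 k21.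
by move: e2; rewrite kk subrr mulr0 => /eqP; rewrite subr_eq0 => /eqP ->.
Qed.

(** The numerators sin^2 agree on the coset and the denominators are the squares of
    [(x + pi * k%:R) / h], so the sum is [h ^+ 2 * sin x ^+ 2] times a cosecant partial sum. *)
Let class_sum m l : l \in ls ->
  h ^+ 2 * (1 - 2 ^- m.+1) <=
    \sum_(k <- iota 0 (2 ^ m.+1)) normc (exp_integral J (tau - pt m l k)) ^+ 2 <= h ^+ 2.
Proof.
move=> ll; have /andP[l0 lp] := ls_itv ll.
pose x := pi * h * (l - tau) - pi * 2 ^+ m.
have pi0 := pi_gt0 R.
have sx : sin x ^+ 2 = sin (pi * h * (l - tau)) ^+ 2.
  have -> : pi * h * (l - tau) = x + pi * (2 ^ m)%N%:R by rewrite /x natrX subrK.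
  by rewrite sqr_sinDpin.
have hl : 0 < h * (l - tau) < 1.
  by rewrite mulr_gt0 ?invr_gt0//= mulrC ltr_pdivrMr// mul1r.
have /andP[hl0 hl1] := hl.
have sx0 : sin x != 0.
  rewrite -sqrf_eq0 sx sqrf_eq0 gt_eqF// sin_gt0_pi// -mulrA mulr_gt0//=.
  by rewrite gtr_pMr.
have xk k : (k < 2 ^ m.+1)%N -> `|x + pi * k%:R| <= 2 ^+ m.+1 * (pi / 2).
  move=> km; have -> : x + pi * k%:R = pi * (h * (l - tau) - 2 ^+ m + k%:R).
    by rewrite /x; ring.
  have -> : 2 ^+ m.+1 * (pi / 2) = pi * 2 ^+ m :> R by rewrite exprS; field.
  rewrite normrM (gtr0_norm pi0) ler_pM2l// ler_norml.
  have : k.+1%:R <= 2 * 2 ^+ m :> R by rewrite -exprS -natrX ler_nat.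
  rewrite -natr1 => km'; have k0 : 0 <= k%:R :> R by [].
  by apply/andP; split; lra.
have := cosecant_sqr_partial_sum sx0 xk.
have -> : \sum_(k <- iota 0 (2 ^ m.+1)) normc (exp_integral J (tau - pt m l k)) ^+ 2 =
    h ^+ 2 * sin x ^+ 2 * \sum_(k < 2 ^ m.+1) (x + pi * k%:R) ^- 2.
  have -> : iota 0 (2 ^ m.+1) = index_iota 0 (2 ^ m.+1) by rewrite /index_iota subn0.
  rewrite big_mkord mulr_sumr.
  apply: eq_bigr => k _.
  have n0 : pt m l k - tau != 0.
    by rewrite subr_eq0; apply/eqP => e; apply: tauL; rewrite -e; exact: ptL.
  have h0 : 0 < h by rewrite invr_gt0.
  rewrite /J exp_integral_segment//; last by rewrite -oppr_eq0 opprB.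
  rewrite -/h -[tau - _]opprB mulrN sinN mulrN invrN mulrNN.
  have e : pi * h * (pt m l k - tau) = x + pi * k%:R.
    by rewrite /pt /x /h; field; rewrite gt_eqF.
  have -> : pi * (pt m l k - tau) = (x + pi * k%:R) / h.
    by rewrite -e; field; rewrite gt_eqF.
  rewrite e !expr_div_n sqr_sinDpin.
  have xk0 : x + pi * k%:R != 0 by rewrite -e !mulf_neq0// ?gt_eqF.
  move: (x + _) xk0 (sin x) => v v0 y.
  by field; rewrite v0 gt_eqF.
set S := \sum_(k < _) _ => /andP[S1 S2].
have s2 : 0 < sin x ^+ 2 by rewrite exprn_even_gt0.
have h2 : 0 < h ^+ 2 by rewrite exprn_gt0// invr_gt0.
have s1 : sin x ^+ 2 <= 1 by rewrite sin2cos2 gerBl sqr_ge0.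
rewrite -mulrA ler_pM2l// -[X in _ <= _ <= X]mulr1 ler_pM2l//.
apply/andP; split; last by rewrite mulrC -ler_pdivlMr// mul1r.
have := ler_wpM2l (ltW s2) S1; rewrite mulrBr divff ?gt_eqF// => /(le_trans _); apply.
rewrite lerD2l lerN2 ler_piMl// invr_ge0 exprn_ge0//.
Qed.

(** The squared coefficients of the modulated indicator of [J] total [h] by Bessel and Parseval,
    while each class contributes [h ^+ 2] in the limit. *)
Lemma card_representatives : (size ls)%:R = p.
Proof.
have h0 : 0 < h by rewrite invr_gt0.
have mJ : measurable J by exact: measurable_itv.
pose W x := normc (exp_integral J (tau - x)) ^+ 2.
have W0 x : 0 <= W x by exact: sqr_ge0.
have sumW m : h ^+ 2 * (1 - 2 ^- m.+1) * (size ls)%:R <= \sum_(x <- pts m) W x <=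
    h ^+ 2 * (size ls)%:R.
  rewrite big_allpairs_dep /=.
  have cst c : c * (size ls)%:R = \sum_(l <- ls) c :> R.
    by rewrite big_const_seq count_predT iter_addr_0 mulr_natr.
  rewrite !cst; apply/andP; split; rewrite big_seq [leRHS]big_seq; apply: ler_sum => l ll.
    by have /andP[] := class_sum m ll.
  by have /andP[] := class_sum m ll.
have hp : h * p = 1 by rewrite mulVf// gt_eqF.
suff hd : h * (size ls)%:R = 1.
  by rewrite -[LHS]mul1r -{1}hp mulrAC hd mul1r.
apply/eqP; rewrite eq_le; apply/andP; split.
  (* Bessel on the block [pts m], with [m] so large that the missing tails cost at most [e]. *)
  apply/ler_addgt0Pr => e e0.
  have hd0 : 0 < h * (size ls)%:R + 1 by rewrite ltr_wpDl// mulr_ge0// ltW.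
  have [m _ /(_ m.+1 (leqnSn m)) /= mP] := near_infty_natSinv_expn_lt (PosNum (divr_gt0 e0 hd0)).
  have /andP[+ _] := sumW m.
  have pL x : x \in pts m -> Lam x by move=> /allpairsP[[l k] /= [ll _ ->]]; exact: ptL.
  move=> /le_trans/(_ (spectral_bessel mOm Om1 sp tau mJ segOm (pts_uniq m) pL)).
  rewrite muJ -[X in _ <= X]mulr1 expr2 -2!mulrA ler_pM2l// mulrCA mulrBl mul1r.
  move=> le1; rewrite (le_trans (y := 1 + 2 ^- m.+1 * (h * (size ls)%:R)))//.
    by rewrite -lerBlDr.
  rewrite lerD2l; move: mP; rewrite div1r ltr_pdivlMr// => /ltW; apply: le_trans.
  by rewrite ler_wpM2l ?invr_ge0 ?exprn_ge0// lerDl.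
(* Parseval: finitely many frequencies carry all but [h * e] of the squared norm, and they lie in
   some block [pts m]. *)
apply/ler_addgt0Pr => e e0.
have [|r [ur rL]] := spectral_parseval_le mOm Om1 sp tau mJ segOm (eps := h * e).
  by rewrite mulr_gt0.
rewrite muJ -/W => lt_r.
have [m rm] : exists m, {subset r <= pts m}.
  pose z x := (x - tau) / p.
  (* [M] exceeds every [|z x|], hence so does [2 ^ M], and all floors fall in the block. *)
  pose M := (Num.truncn (\sum_(x <- r) `|z x|)).+1.
  exists M => x xr; have [l ll xE] := representative (rL x xr).
  have : `|z x| < 2 ^+ M.
    apply: (@le_lt_trans _ _ (\sum_(x <- r) `|z x|)).
      by rewrite (big_rem x)//= lerDl sumr_ge0.
    by rewrite (lt_trans (truncnS_gt _))// -natrX ltr_nat ltn_expl.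
  rewrite ltr_norml => /andP[z1 z2].
  have : 0 <= Num.floor (z x) + (2 ^ M)%N%:Z.
    by rewrite -lerBlDr sub0r floor_ge_int mulrNz -pmulrn natrX ltW.
  have : Num.floor (z x) + (2 ^ M)%N%:Z < (2 ^ M.+1)%N%:Z.
    rewrite expnS mul2n -addnn PoszD ltrD2r floor_lt_int -pmulrn natrX//.
  move E : (_ + _) => n; case: n E => // n E; rewrite ltz_nat => nM _.
  apply/allpairsP; exists (l, n); split; rewrite //= ?mem_iota//.
  rewrite xE /pt -/(z x); have := congr1 (fun k : int => k%:~R : R) E.
  by rewrite intrD -!pmulrn natrX => <-; ring.
have /andP[_] := sumW m.
move=> /(le_trans (sum_uniq_sub ur (pts_uniq m) rm W0)) /(lt_le_trans lt_r).
have -> : h ^+ 2 * (size ls)%:R = h * (h * (size ls)%:R) by rewrite expr2 mulrA.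
have -> : h - h * e = h * (1 - e) by rewrite mulrBr mulr1.
by rewrite ltr_pM2l// => /ltW; rewrite lerBlDr.
Qed.

End Representatives.
End IntegerPeriod.

(** * Choice of the period and conclusion *)

Lemma itv_union_segment (R : realType) (n : nat) (I : 'I_n -> interval R) (Om : set R) :
  Om = \bigcup_(j in [set: 'I_n]) [set` I j] -> lebesgue_measure Om = 1%E ->
  exists a h : R, 0 < h /\ [set` `[a, a + h]] `<=` Om.
Proof.
move=> OmE Om1.
have [j jlt] : exists j, ((I j).1 < (I j).2)%E.
  apply: contrapT => no.
  suff : (lebesgue_measure Om = 0 :> \bar R)%E by rewrite Om1 => /eqP; rewrite onee_eq0.
  apply/(@negligibleP _ _ _ lebesgue_measure).
    by rewrite OmE; apply: fin_bigcup_measurable.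
  rewrite OmE (_ : [set: 'I_n] = [set` predT]); last by apply/seteqP; split.
  rewrite bigcup_pred; elim/big_ind : _ => [|A B nA nB|j _].
  - exact: negligible_set0.
  - exact: negligibleU.
  - have Ij0 : lebesgue_measure [set` I j] = 0%E.
      by rewrite lebesgue_measure_itv; case: ifPn => // jlt; case: no; exists j.
    by apply/negligibleP.
have jOm : [set` I j] `<=` Om by rewrite OmE => x xj; exists j.
have joo : (lebesgue_measure [set` I j] < +oo)%E.
  apply: (@le_lt_trans _ _ (lebesgue_measure Om)); last by rewrite Om1 ltry.
  apply: le_measure => //; rewrite inE//.
  by rewrite OmE; apply: fin_bigcup_measurable.
move: joo jlt jOm; rewrite lebesgue_measure_itv.
case: (I j) => [[b1 a|[]] [b2 b|[]]] //= joo; rewrite ?lte_fin// => ab jOm;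
  [|by rewrite ltry in joo|by rewrite ltNyr in joo].
(* The middle half avoids both endpoints, which may or may not belong to the interval. *)
exists (a + (b - a) / 4), ((b - a) / 2); split; first by rewrite divr_gt0// subr_gt0.
move=> x /= /[!in_itv]/= /andP[x1 x2]; apply: jOm; rewrite /= itv_boundlr.
apply/andP; split.
  by case: b1 {joo}; rewrite bnd_simp; lra.
by case: b2 {joo}; rewrite bnd_simp; lra.
Qed.

(** Seen from one element [b] of the window, the others are orthogonal differences of bounded
    size. *)
Lemma finite_representatives (R : realType) (Om : set (measurableTypeR R)) (Lam : set R)
    (s : seq (R * R)) (tau p : R) :
  measurable Om -> lebesgue_measure Om = 1%E -> spectral_pair Om Lam ->
  (forall F f : R -> R, (forall x : R, is_derive x 1 F (f x)) -> continuous f ->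
    \int[lebesgue_measure]_(x in Om) f x = \sum_(u <- s) u.1 * F u.2) ->
  exists2 ls : seq R, uniq ls & forall x, x \in ls <-> Lam x /\ tau <= x < tau + p.
Proof.
move=> mOm Om1 sp srep.
have [[b [Lb b12]]|no] := pselect (exists b, Lam b /\ tau <= b < tau + p); last first.
  by exists [::] => // x; split => // xL; case: no; exists x.
have [zs zsP] := finite_orthogonal_diff mOm Om1 srep (Num.truncn p).+1.
exists (undup [seq x <- [seq b + z | z <- zs] | (x \in Lam) && (tau <= x < tau + p)]).
  exact: undup_uniq.
move=> x; rewrite mem_undup mem_filter; split => [/andP[/andP[/set_mem]]//|[Lx x12]].
rewrite (mem_set Lx) x12 /=; apply/mapP; exists (x - b); last by rewrite addrC subrK.
apply: zsP; first exact: (spectrum_orthogonal_diff mOm Om1 sp srep).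
have := truncnS_gt p; move: b12 x12 => /andP[b1 b2] /andP[x1 x2] pt.
by rewrite ler_norml; apply/andP; split; lra.
Qed.

Theorem theorem1p4 (R : realType) (n : nat) (I : 'I_n -> interval R)
    (Omega Lambda : set R) :
  Omega = \bigcup_(j in [set: 'I_n]) [set` I j] ->
  lebesgue_measure Omega = 1%E ->
  spectral_pair Omega Lambda ->
  exists d : nat,
    [/\ (0 < d)%N,
        periodic_set d%:R Lambda &
        exists l : 'I_d -> R,
          Lambda = \bigcup_(j in [set: 'I_d]) coset d%:R (l j)].
Proof.
move=> OmE Om1 sp.
have mOm : measurable Omega by rewrite OmE; apply: fin_bigcup_measurable.
have [|s srep] := itv_union_Rintegral OmE; first by rewrite Om1 ltry.
have [p0 p00 p0P] := spectrum_periodic mOm Om1 sp srep.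
have [d0 d00 d0P] := spectrum_separated mOm Om1 sp srep.
have [a [h [h0 aOm]]] := itv_union_segment OmE Om1.
(* [N] makes the multiple [p] of the period so large that a segment of length [p^-1] fits in
   [Omega]. *)
pose N := (Num.truncn (h^-1 / p0)).+1; pose p := p0 * N%:R.
have p_gt0 : 0 < p by rewrite mulr_gt0// ltr0n.
have pP x : Lambda x <-> Lambda (x + p).
  by have := periodic_int p0P N%:Z x; rewrite -pmulrn.
have ph : p^-1 <= h.
  rewrite -[h]invrK lef_pV2 ?posrE ?invr_gt0// /p mulrC -ler_pdivrMr//.
  exact: ltW (truncnS_gt _).
have pOm : [set` `[a, a + p^-1]] `<=` Omega.
  move=> x /= /[!in_itv]/= /andP[x1 x2]; apply: aOm; rewrite /= in_itv /= x1 /=.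
  by rewrite (le_trans x2)// lerD2l.
have [tau tauL] := avoiding_point d00 d0P.
have [ls uls lsP] := finite_representatives tau p mOm Om1 sp srep.
(* The positive real [p] is thereby a number of cosets, hence a positive integer. *)
have pE := card_representatives mOm Om1 sp p_gt0 pP pOm tauL uls lsP.
have LE x : Lambda x <-> exists2 l, l \in ls & coset (size ls)%:R l x.
  split => [Lx|[l /lsP[Ll _] [k ->]]]; last first.
    by rewrite pE; exact: (periodic_int pP k l).1.
  have [l ll xE] := representative p_gt0 pP lsP Lx.
  by exists l => //; rewrite /coset /= pE; eexists; exact: xE.
exists (size ls); split.
- by rewrite -(ltr0n R) pE.
- exists [set` ls]; first exact: finite_seq.
  by apply/seteqP; split => x; [move=> /LE[l]; exists l|move=> [l ll xl]; apply/LE; exists l].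
- exists (fun j => ls`_j); apply/seteqP; split => x.
    move=> /LE[l ll xl]; have il : (index l ls < size ls)%N by rewrite index_mem.
    by exists (Ordinal il) => //=; rewrite nth_index.
  by move=> [j _ xj]; apply/LE; exists ls`_j => //; exact: mem_nth.
Qed.
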